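(* Assume $\mathbb{E}\|X_1\|^2<\infty$, that the true parameter $\theta_0\in\mathbb{R}^d$ satisfies $\|\theta_0\|_2=1$, and that $s^*:=\|\theta_0\|_0<n$. Use as prior the spike and slab prior $$\pi_\xi(\theta)=\prod_{i=1}^d\left[p\,\phi(\theta_i;0,v_1)+(1-p)\,\phi(\theta_i;0,v_0)\right],\qquad \xi=(p,v_0,v_1)\in[0,1]\times(\mathbb{R}^+)^2,\ v_0\ll v_1,$$ with $p=1-e^{-1/d}$ and $v_0\le \frac{1}{2n^2 d\log d}$. Put $K_1:=2\,\mathbb{E}\|X_1\|$ and $$\varepsilon_n=\frac{K_1\vee s^*\log(nd)}{n}.$$ Then, for every $\alpha\in(0,1)$, $$\mathbb{P}\left[\int D_\alpha(P_\theta,P_{\theta_0})\,\pi_{n,\alpha}(\mathrm{d}\theta)\le c_{v_1}\frac{2(\alpha+1)}{1-\alpha}\,\varepsilon_n\right]\ge 1-\frac{2}{n\varepsilon_n},$$ where $c_{v_1}>0$ is a constant depending only on $v_1$.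
   Context: Model: $Z_i=(Y_i,X_i)\in\{-1,1\}\times\mathbb{R}^d$, $i=1,\dots,n$, are i.i.d. For $\theta\in\mathbb{R}^d$, $P_\theta$ is the joint law of $(Y,X)$ for which $X$ has a fixed marginal law not depending on $\theta$ and $p_\theta(y|x)=\mathbb{P}(Y=y\mid X=x,\theta)=\frac{e^{yx^\top\theta}}{1+e^{yx^\top\theta}}$. The data are drawn from $\mathbb{P}=P_{\theta_0}^{\otimes n}$ (well-specified case). $\|\cdot\|=\|\cdot\|_2$ is the Euclidean norm, $\|\theta\|_0$ the number of nonzero entries of $\theta$, and $a\vee b=\max(a,b)$. $\phi(\cdot;a,b)$ is the Gaussian density with mean $a$ and variance $b$; $v_0\ll v_1$ means informally that $v_0$ is much smaller than $v_1$. Fractional posterior (with prior $\pi=\pi_\xi$): $\pi_{n,\alpha}(\mathrm{d}\theta)\propto L_n(\theta)^\alpha\,\pi(\mathrm{d}\theta)$, where $L_n(\theta)=\prod_{i=1}^n p_\theta(Y_i|X_i)$; it depends on the data $Z_1,\dots,Z_n$. Rényi divergence: for $\alpha\in(0,1)$ and probability measures $P,R$ dominated by $\mu$, $D_\alpha(P,R)=\frac{1}{\alpha-1}\log\int\left(\frac{\mathrm{d}P}{\mathrm{d}\mu}\right)^\alpha\left(\frac{\mathrm{d}R}{\mathrm{d}\mu}\right)^{1-\alpha}\mathrm{d}\mu$. *)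

(* Defs.v *)
From HB Require Import structures.
From mathcomp Require Import all_boot all_order all_algebra.
From mathcomp Require Import all_classical all_reals all_analysis.
From mathcomp Require Import measurable_realfun.

Set Implicit Arguments.
Unset Strict Implicit.
Unset Printing Implicit Defensive.
Import Order.TTheory GRing.Theory Num.Theory.
Import numFieldNormedType.Exports.

Local Open Scope classical_set_scope.
Local Open Scope ring_scope.

Section density_measure.
Context d (T : measurableType d) (R : realType).
Variables (mu : {measure set T -> \bar R}) (f : T -> \bar R).
Hypotheses (mf : measurable_fun [set: T] f) (f0 : forall x, (0 <= f x)%E).

(* The two proof arguments do not occur in the value; they are there so that
   the measure structure can be inferred. *)
Definition density_measure of measurable_fun [set: T] f
  & (forall x, (0 <= f x)%E) : set T -> \bar R :=
  fun A => (\int[mu]_(x in A) f x)%E.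

Local Notation nu := (density_measure mf f0).

Let nu0 : nu set0 = 0%E.
Proof. exact: integral_set0. Qed.

Let nu_ge0 A : (0 <= nu A)%E.
Proof. by apply: integral_ge0 => x _; exact: f0. Qed.

Let nu_sigma_additive : semi_sigma_additive nu.
Proof. exact: semi_sigma_additive_nng_induced. Qed.

HB.instance Definition _ :=
  isMeasure.Build _ _ _ nu nu0 nu_ge0 nu_sigma_additive.

End density_measure.
Arguments density_measure {d T R} mu {f} mf f0.

(* n.-tuple T carries the product sigma-algebra; tuple_product_measure m n is
   the n-fold product of m with itself, built from binary products. *)
Section tuple_product.
Local Open Scope ereal_scope.
Context d (T : measurableType d) (R : realType).

Definition tuple_cons n (x : T * n.-tuple T) : n.+1.-tuple T :=
  [tuple of x.1 :: x.2].

Lemma measurable_tuple_cons n : measurable_fun [set: _] (@tuple_cons n).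
Proof. exact: measurable_cons. Qed.

HB.instance Definition _ n :=
  isMeasurableFun.Build _ _ _ _ (@tuple_cons n) (@measurable_tuple_cons n).

Section cons_measure.
Variables (m1 : {sigma_finite_measure set T -> \bar R}) (n : nat)
  (m2 : {sigma_finite_measure set (n.-tuple T) -> \bar R}).

Definition cons_measure : set (n.+1.-tuple T) -> \bar R :=
  pushforward (m1 \x m2) (@tuple_cons n).

Let cons_measure0 : cons_measure set0 = 0.
Proof. exact: measure0. Qed.

Let cons_measure_ge0 A : 0 <= cons_measure A.
Proof. exact: measure_ge0. Qed.

Let cons_measure_sigma_additive : semi_sigma_additive cons_measure.
Proof. exact: measure_semi_sigma_additive. Qed.

HB.instance Definition _ := isMeasure.Build _ _ _ cons_measure
  cons_measure0 cons_measure_ge0 cons_measure_sigma_additive.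

Let cons_measure_sigma_finite : sigma_finite setT cons_measure.
Proof.
have /sigma_finiteP[F [TF ndF Foo]] := sigma_finiteT m1.
have /sigma_finiteP[G [TG ndG Goo]] := sigma_finiteT m2.
pose uncons (t : n.+1.-tuple T) := (thead t, [tuple of behead t]).
have muncons : measurable_fun setT uncons.
  apply/measurable_fun_pairP; split; first exact: measurable_tnth.
  exact: measurable_behead.
have unconsK : uncons \o @tuple_cons n = id.
  rewrite funeqE => -[x t] /=.
  by rewrite /uncons /tuple_cons/= theadE; congr pair; exact: val_inj.
exists (fun k => uncons @^-1` (F k `*` G k)).
  apply/seteqP; split=> // t _.
  have [k _ Fk] : (\bigcup_k F k) (uncons t).1 by rewrite -TF.
  have [l _ Gl] : (\bigcup_l G l) (uncons t).2 by rewrite -TG.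
  exists (maxn k l) => //; split.
  - by move: Fk; apply: subsetPset; apply: ndF; exact: leq_maxl.
  - by move: Gl; apply: subsetPset; apply: ndG; exact: leq_maxr.
move=> k; have [mF Fk] := Foo k; have [mG Gk] := Goo k.
have mFG : measurable (F k `*` G k) by exact: measurableX.
split; first by rewrite -[X in measurable X]setTI; exact: muncons.
rewrite /cons_measure /pushforward -comp_preimage unconsK preimage_id.
by rewrite product_measure1E// lte_mul_pinfty// ge0_fin_numE.
Qed.

HB.instance Definition _ := Measure_isSigmaFinite.Build _ _ _ cons_measure
  cons_measure_sigma_finite.

End cons_measure.

Fixpoint tuple_product_measure (m : {sigma_finite_measure set T -> \bar R}) n :
    {sigma_finite_measure set (n.-tuple T) -> \bar R} :=
  match n with
  | 0%N => dirac [tuple]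
  | n'.+1 => cons_measure m (tuple_product_measure m n')
  end.

End tuple_product.

(* Meaningful when mu dominates P and Q, and then independent of mu.  The
   extended logarithm makes the divergence +oo when P and Q are mutually
   singular (0 < a < 1). *)
Definition renyi_divergence d (T : measurableType d) (R : realType)
    (mu : {sigma_finite_measure set T -> \bar R}) (a : R)
    (P Q : probability T R) : \bar R :=
  (((a - 1)^-1)%:E *
   lne (\int[mu]_x
     (poweR (Radon_Nikodym (charge_of_finite_measure P) mu x) a *
      poweR (Radon_Nikodym (charge_of_finite_measure Q) mu x) (1 - a))))%E.

(* measurableTypeR R is R with its Borel sigma-algebra. *)
Notation Rd R d := (d.-tuple (measurableTypeR R)).

Section euclidean.
Context (R : realType) (d : nat).

Definition dot (x y : Rd R d) : R := \sum_(i < d) (tnth x i : R) * (tnth y i : R).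

Definition norm2 (x : Rd R d) : R := Num.sqrt (\sum_(i < d) (tnth x i : R) ^+ 2).

Definition norm0 (x : Rd R d) : nat := #|[set i : 'I_d | (tnth x i : R) != 0]|%SET.

End euclidean.

Section logistic_model.
Context (R : realType) (d : nat).

(* The label set {-1, 1} is encoded by bool. *)
Definition label (y : bool) : R := if y then 1 else -1.

Definition label_counting : set bool -> \bar R :=
  measure_add (\d_true) (\d_false).

HB.instance Definition _ := Measure.on label_counting.

Let label_counting_finite : fin_num_fun label_counting.
Proof.
move=> A mA; rewrite /label_counting measure_addE fin_numD.
by rewrite !fin_num_measure.
Qed.

HB.instance Definition _ :=
  Measure_isFinite.Build _ _ _ label_counting label_counting_finite.

Definition logistic (theta : Rd R d) (y : bool) (x : Rd R d) : R :=
  expR (label y * dot x theta) / (1 + expR (label y * dot x theta)).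

Lemma logistic_ge0 theta y x : 0 <= logistic theta y x.
Proof. by rewrite divr_ge0 ?addr_ge0 ?expR_ge0. Qed.

Lemma logistic_sum1 theta x : logistic theta true x + logistic theta false x = 1.
Proof.
rewrite /logistic /label mul1r mulN1r expRN.
have e0 := expR_gt0 (dot x theta); set e := expR _ in e0 *.
have e1 : 1 + e != 0 by rewrite gt_eqF// addr_gt0.
have -> : 1 + e^-1 = (1 + e) / e by rewrite mulrDl mul1r divff ?gt_eqF// addrC.
by rewrite invfM invrK mulrCA mulVf ?gt_eqF// mulr1 -[X in _ + X]mul1r -mulrDl addrC divff.
Qed.

Lemma measurable_logistic e (T : measurableType e)
    (theta x : T -> Rd R d) (y : T -> bool) :
  measurable_fun [set: T] theta -> measurable_fun [set: T] x ->
  measurable_fun [set: T] y ->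
  measurable_fun [set: T] (fun t => logistic (theta t) (y t) (x t)).
Proof.
move=> mtheta mx my.
pose g (u : R) : R := expR u / (1 + expR u).
have cg : continuous g.
  move=> u; apply: cvgM; first exact: continuous_expR.
  apply: cvgV; first by rewrite gt_eqF// addr_gt0// expR_gt0.
  by apply: cvgD; [exact: cvg_cst|exact: continuous_expR].
apply: (measurableT_comp (continuous_measurable_fun cg)).
apply: measurable_funM.
  by apply: (@measurableT_comp _ _ _ _ _ _ label).
apply: measurable_sum => i; apply: measurable_funM;
  exact: (measurableT_comp (measurable_tnth i)).
Qed.

Section law.
Variable PX : probability (Rd R d) R.

(* Counting measure on the labels times the law PX of the covariate: the law
   P_theta of (Y, X) has density p_theta(y|x) with respect to it. *)
Definition logistic_base : set (bool * Rd R d) -> \bar R :=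
  (label_counting \x PX)%E.

HB.instance Definition _ := Measure.on logistic_base.

Let logistic_base_finite : fin_num_fun logistic_base.
Proof.
apply: lty_fin_num_fun.
rewrite [ltLHS](_ : _ = label_counting setT * PX setT)%E; last first.
  have := product_measure1E label_counting PX measurableT measurableT.
  by rewrite setXTT.
by rewrite probability_setT mule1 -ge0_fin_numE// fin_num_measure.
Qed.

HB.instance Definition _ :=
  Measure_isFinite.Build _ _ _ logistic_base logistic_base_finite.

Definition logistic_pdf (theta : Rd R d) (z : bool * Rd R d) : \bar R :=
  (logistic theta z.1 z.2)%:E.

Lemma measurable_logistic_pdf theta :
  measurable_fun [set: bool * Rd R d] (logistic_pdf theta).
Proof.
by apply/measurable_EFinP; apply: measurable_logistic.
Qed.

Lemma logistic_pdf_ge0 theta z : (0 <= logistic_pdf theta z)%E.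
Proof. by rewrite lee_fin logistic_ge0. Qed.

Definition logistic_law (theta : Rd R d) : set (bool * Rd R d) -> \bar R :=
  density_measure logistic_base
    (measurable_logistic_pdf theta) (logistic_pdf_ge0 theta).

HB.instance Definition _ theta := Measure.on (logistic_law theta).

Let logistic_law1 theta : logistic_law theta [set: _] = 1%E.
Proof.
have mf y : measurable_fun [set: Rd R d] (fun x => logistic_pdf theta (y, x)).
  by apply/measurable_EFinP; apply: measurable_logistic => //=.
have F0 y : (0 <= \int[PX]_x logistic_pdf theta (y, x))%E.
  by apply: integral_ge0 => x _; exact: logistic_pdf_ge0.
rewrite /logistic_law /density_measure /logistic_base.
rewrite (@fubini_tonelli1 _ _ _ _ _ label_counting PX)//=; last 2 first.
- exact: measurable_logistic_pdf.
- exact: logistic_pdf_ge0.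
rewrite /label_counting ge0_integral_measure_add//; last by move=> y _; exact: F0.
rewrite !integral_dirac// !diracT !mul1e /fubini_F.
rewrite -ge0_integralD//; last 2 first.
- by move=> x _; exact: logistic_pdf_ge0.
- by move=> x _; exact: logistic_pdf_ge0.
under eq_integral do rewrite /logistic_pdf/= -EFinD logistic_sum1.
by rewrite integral_cst// mul1e; exact: probability_setT.
Qed.

HB.instance Definition _ theta :=
  Measure_isProbability.Build _ _ _ (logistic_law theta) (logistic_law1 theta).

End law.
End logistic_model.
Arguments label : clear implicits.
Arguments label_counting : clear implicits.

Section posterior.
Context (R : realType) (d : nat).

(* normal_pdf takes the standard deviation, v0 and v1 are variances. *)
Definition spike_slab_pdf (p : {i01 R}) (v0 v1 : R) (theta : Rd R d) : R :=
  \prod_(i < d) (p%:num * normal_pdf 0 (Num.sqrt v1) (tnth theta i)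
                 + (1 - p%:num) * normal_pdf 0 (Num.sqrt v0) (tnth theta i)).

Lemma spike_slab_pdf_ge0 p v0 v1 theta :
  (0 <= (spike_slab_pdf p v0 v1 theta)%:E)%E.
Proof.
rewrite lee_fin; apply: prodr_ge0 => i _.
by rewrite addr_ge0// mulr_ge0// ?normal_pdf_ge0// subr_ge0.
Qed.

Lemma measurable_spike_slab_pdf p v0 v1 :
  measurable_fun [set: Rd R d] (fun theta => (spike_slab_pdf p v0 v1 theta)%:E).
Proof.
apply/measurable_EFinP; apply: measurable_prod => i _.
have mt v : measurable_fun [set: Rd R d]
    (fun theta => normal_pdf 0 v (tnth theta i) : R).
  by apply: (measurableT_comp (measurable_normal_pdf 0 v)); exact: measurable_tnth.
by apply: measurable_funD; apply: measurable_funM => //; exact: mt.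
Qed.

Definition lebesgue_Rd : {sigma_finite_measure set (Rd R d) -> \bar R} :=
  tuple_product_measure (@lebesgue_measure R) d.

Definition spike_slab_prior (p : {i01 R}) (v0 v1 : R) : set (Rd R d) -> \bar R :=
  density_measure lebesgue_Rd
    (measurable_spike_slab_pdf p v0 v1) (spike_slab_pdf_ge0 p v0 v1).

HB.instance Definition _ p v0 v1 := Measure.on (spike_slab_prior p v0 v1).

Definition likelihood n (z : n.-tuple (bool * Rd R d)) (theta : Rd R d) : R :=
  \prod_(i < n) logistic theta (tnth z i).1 (tnth z i).2.

Lemma tempered_likelihood_ge0 n (z : n.-tuple (bool * Rd R d)) (a : R) theta :
  (0 <= (likelihood z theta `^ a)%:E)%E.
Proof. by rewrite lee_fin powR_ge0. Qed.

Lemma measurable_tempered_likelihood n (z : n.-tuple (bool * Rd R d)) (a : R) :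
  measurable_fun [set: Rd R d] (fun theta => (likelihood z theta `^ a)%:E).
Proof.
apply/measurable_EFinP.
apply: (measurableT_comp (measurable_powR a)).
by apply: measurable_prod => i _; apply: measurable_logistic.
Qed.

(* mnormalize falls back on its second argument, here a point mass at 0, only
   if the total mass to normalize is 0 or +oo. *)
Definition fractional_posterior n (prior : {measure set (Rd R d) -> \bar R})
    (a : R) (z : n.-tuple (bool * Rd R d)) : set (Rd R d) -> \bar R :=
  mnormalize
    (density_measure prior
       (measurable_tempered_likelihood z a) (tempered_likelihood_ge0 z a))
    (\d_ ([tuple of nseq d 0] : Rd R d)).

HB.instance Definition _ n prior a (z : n.-tuple (bool * Rd R d)) :=
  Probability.on (fractional_posterior prior a z).

End posterior.

(* Main.v *)
(** With [D = D_a(P_theta, P_theta0)], [A = exp(- (1 - a) D)] and [r_n] the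
likelihood ratio of [theta] against [theta0], the prior integral [U] of
[r_n^a A^-n] has mean 1.  With probability at least [1 - 1/N], where
[N = n eps], Markov's inequality gives [U <= N], and Jensen's inequality
then bounds the posterior mean of [(1 - a) n D] by [ln (U / V)], where [V] is
the prior integral of [r_n^a].

It remains to bound [V] below by [exp(- c N)] with probability [1 - 1/N].  The
covariates may be heavy-tailed, so integrating the log-likelihood ratio
against a fixed perturbation of [theta0] is too crude: only Markov's inequality
is available for [sum |X_i|].  Instead, [r_n^a >= prod exp(- |X_i . (theta - theta0)|)],
the prior dominates a centred Gaussian at [theta0] with all standard deviations at most
[1/n], and each factor is minorized by a Gaussian factor.  The matrix determinant
lemma then yields [V >= const * prod (1 + |X_i| / n)^-2], and the mean of
[prod (1 + |X_i| / n)] is at most [exp (E|X|)]. *)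
Require Import Defs.
From HB Require Import structures.
From mathcomp Require Import all_boot all_order all_algebra.
From mathcomp Require Import all_classical all_reals all_analysis.
From mathcomp Require Import measurable_realfun ring lra.

Import Order.TTheory GRing.Theory Num.Theory.
Import numFieldNormedType.Exports.

Local Open Scope classical_set_scope.
Local Open Scope ring_scope.

Set Implicit Arguments.
Unset Strict Implicit.

(** * Tonelli on product spaces *)

(** True for indicators by definition of the density measure, for simple functions by linearity, and
    in general by monotone convergence. Finiteness of [g] lets the limit pass through the product
    with [g x]. *)
Lemma ge0_integral_density {d : measure_display} {T : measurableType d}
    {R : realType} (mu : {measure set T -> \bar R}) (g : T -> \bar R)
    (mg : measurable_fun [set: T] g) (g0 : forall x, (0 <= g x)%E)
    (f : T -> \bar R) :
  measurable_fun [set: T] f -> (forall x, (0 <= f x)%E) ->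
  (forall x, g x \is a fin_num) ->
  (\int[density_measure mu mg g0]_x f x = \int[mu]_x (f x * g x))%E.
Proof.
Import HBNNSimple.
move=> mf f0 gfin.
pose h := nnsfun_approx measurableT mf.
have hf x : (EFin \o h ^~ x) n @[n --> \oo] --> f x.
  by apply: cvg_nnsfun_approx.
have mh n : measurable_fun setT (fun x => (h n x)%:E).
  exact/measurable_EFinP.
have hmono x : {homo (fun n => (h n x)%:E) : a b / (a <= b)%N >-> (a <= b)%E}.
  by move=> a b ab; rewrite lee_fin; exact/lefP/nd_nnsfun_approx.
transitivity (limn (fun n => \int[density_measure mu mg g0]_x (h n x)%:E)%E).
  rewrite -monotone_convergence//.
  - by apply: eq_integral => x _; apply/esym/cvg_lim => //; exact: hf.
  - by move=> n x _; rewrite lee_fin.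
transitivity (limn (fun n => \int[mu]_x ((h n x)%:E * g x))%E); last first.
  rewrite -monotone_convergence//.
  - apply: eq_integral => x _; apply/cvg_lim => //.
    by apply: cvgeZr; [exact: gfin|exact: hf].
  - by move=> n; apply: emeasurable_funM.
  - by move=> n x _; rewrite mule_ge0// lee_fin.
  - by move=> x _ a b ab; rewrite lee_wpmul2r// hmono.
congr (limn _); apply/funext => n.
transitivity (\int[density_measure mu mg g0]_x
   (\sum_(y \in range (h n)) (y * \1_(h n @^-1` [set y]) x)%:E))%E.
  by apply: eq_integral => t _; rewrite /= fimfunE -fsumEFin.
have indich r : measurable_fun setT (fun x => (r * \1_(h n @^-1` [set r]) x)%:E).
  by apply: (measurable_comp measurableT) => //; exact: measurable_funM.
rewrite ge0_integral_fsum//; last by move=> m y Ey; exact: nnfun_muleindic_ge0.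
transitivity (\int[mu]_x (\sum_(y \in range (h n))
    (y * \1_(h n @^-1` [set y]) x)%:E * g x))%E; last first.
  apply: eq_integral => x _.
  rewrite -ge0_mule_fsuml => [|y]; last exact: nnfun_muleindic_ge0.
  by rewrite fsumEFin // -(fimfunE _ x).
rewrite ge0_integral_fsum//; last 2 first.
  - by move=> y; apply: emeasurable_funM.
  - by move=> m y _; rewrite mule_ge0// nnfun_muleindic_ge0.
apply: eq_fsbigr => r rhn.
under eq_integral do rewrite EFinM.
rewrite integralZl_indic_nnsfun => //.
under [RHS]eq_integral do rewrite EFinM -muleA.
rewrite [RHS]ge0_integralZl//.
- rewrite [in RHS](eq_integral (g \_ (h n @^-1` [set r]))); last first.
    by move=> x xE; rewrite epatch_indic muleC.
  by rewrite -integral_mkcond integral_indic// setIT.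
- by apply: emeasurable_funM => //; exact/measurable_EFinP.
- by move=> t _; rewrite mule_ge0// lee_fin.
- by move: rhn; rewrite inE => -[t _ <-]; rewrite lee_fin.
Qed.

Section tuple_tonelli.
Local Open Scope ereal_scope.
Context {d : measure_display} {T : measurableType d} {R : realType}.
Variable m : {sigma_finite_measure set T -> \bar R}.

Lemma measurable_tuple_cons2 n :
  measurable_fun [set: T * n.-tuple T] (fun p => [tuple of p.1 :: p.2]).
Proof. exact: measurable_cons. Qed.

Lemma integral_tuple0 (f : 0.-tuple T -> \bar R) :
  measurable_fun setT f ->
  \int[tuple_product_measure m 0]_t f t = f [tuple].
Proof. by move=> mf; rewrite integral_dirac// diracT mul1e. Qed.

Lemma integral_tupleS n (f : n.+1.-tuple T -> \bar R) :
  measurable_fun setT f -> (forall t, 0 <= f t) ->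
  \int[tuple_product_measure m n.+1]_t f t =
  \int[m]_x \int[tuple_product_measure m n]_t f [tuple of x :: t].
Proof.
move=> mf f0.
have mfc : measurable_fun [set: T * n.-tuple T]
    (fun p : T * n.-tuple T => f [tuple of p.1 :: p.2]).
  exact: (measurableT_comp mf (@measurable_tuple_cons2 n)).
rewrite [LHS](_ : _ = \int[(m \x tuple_product_measure m n)]_p
    f [tuple of p.1 :: p.2]).
  by rewrite fubini_tonelli1.
by rewrite [LHS]ge0_integral_pushforward//; exact: measurable_tuple_cons.
Qed.

(** Integrating the head coordinate first is the order in which [gauss_form] completes the
    squares. *)
Lemma integral_tupleS_sym n (f : n.+1.-tuple T -> \bar R) :
  measurable_fun setT f -> (forall t, 0 <= f t) ->
  \int[tuple_product_measure m n.+1]_t f t =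
  \int[tuple_product_measure m n]_t \int[m]_x f [tuple of x :: t].
Proof.
move=> mf f0; rewrite integral_tupleS//.
apply: (fubini_tonelli (fun p : T * n.-tuple T => f [tuple of p.1 :: p.2])) => //.
exact: (measurableT_comp mf (@measurable_tuple_cons2 n)).
Qed.

Lemma measurable_prod_tuple n (g : 'I_n -> T -> R) :
  (forall i, measurable_fun setT (g i)) ->
  measurable_fun [set: n.-tuple T] (fun t => (\prod_(i < n) g i (tnth t i))%:E).
Proof.
move=> mg; apply/measurable_EFinP; apply: measurable_prod => i _.
by apply: (measurableT_comp (mg i)); exact: measurable_tnth.
Qed.

(** Independence of the coordinates, by induction with Tonelli. It serves both the i.i.d. sample and
    the product form of the prior. *)
Lemma integral_tuple_prod n (g : 'I_n -> T -> R) :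
  (forall i, measurable_fun setT (g i)) -> (forall i x, (0 <= g i x)%R) ->
  \int[tuple_product_measure m n]_t (\prod_(i < n) g i (tnth t i))%:E =
  \prod_(i < n) \int[m]_x (g i x)%:E.
Proof.
elim: n g => [|n IH] g mg g0.
  rewrite integral_tuple0 ?big_ord0//; exact: measurable_prod_tuple.
rewrite integral_tupleS; last 2 first.
- exact: measurable_prod_tuple.
- by move=> t; rewrite lee_fin prodr_ge0.
have I0 i : 0 <= \int[m]_x (g i x)%:E.
  by apply: integral_ge0 => x _; rewrite lee_fin.
transitivity (\int[m]_x ((g ord0 x)%:E *
    \int[tuple_product_measure m n]_t
      (\prod_(i < n) g (lift ord0 i) (tnth t i))%:E)).
  apply: eq_integral => x _.
  rewrite -ge0_integralZl//; last 3 first.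
  - exact: (@measurable_prod_tuple n (fun i => g (lift ord0 i)) (fun i => mg (lift ord0 i))).
  - by move=> t _; rewrite lee_fin prodr_ge0.
  - by rewrite lee_fin.
  apply: eq_integral => t _; rewrite -EFinM big_ord_recl/=; congr (_ * _)%:E.
  by apply: eq_bigr => i _; rewrite tnthS.
rewrite ge0_integralZr//; last 3 first.
- exact/measurable_EFinP.
- by move=> x _; rewrite lee_fin.
- by apply: integral_ge0 => t _; rewrite lee_fin prodr_ge0.
by rewrite big_ord_recl (IH (fun i => g (lift ord0 i))) => [|i|i x].
Qed.

Lemma tuple_product_measureT n : m setT = 1 ->
  tuple_product_measure m n setT = 1.
Proof.
move=> m1.
have := @integral_tuple_prod n (fun _ _ => 1%R) (fun _ => measurable_cst _)
  (fun _ _ => ler01).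
under eq_integral do rewrite big1//.
rewrite integral_cst// mul1e => ->.
by rewrite big1// => i _; rewrite integral_cst// mul1e.
Qed.

End tuple_tonelli.

(** * Gaussian integrals of quadratic forms *)

Lemma quad_ge0_discr {R : realType} (a b c : R) :
  (forall k, 0 <= a * k ^+ 2 + 2 * b * k + c) -> 0 <= a /\ b ^+ 2 <= a * c.
Proof.
move=> H; have c0 : 0 <= c by have := H 0; rewrite expr0n !mulr0 !add0r.
have a0 : 0 <= a.
  rewrite leNgt; apply/negP => alt0.
  (* Adding the values at [t] and [- t] cancels the linear term and leaves [2 * (a * t ^+ 2 + c)],
     which is negative since [- a * t ^+ 2 >= - a * t = c - a > c]. *)
  pose t := 1 + c / - a.
  have := addr_ge0 (H t) (H (- t)).
  have t1 : 1 <= t by rewrite lerDl divr_ge0// oppr_ge0 ltW.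
  have tc : - a * t = - a + c by rewrite /t; field; rewrite lt_eqF.
  have : 0 <= - a * (t * (t - 1)).
    by rewrite !mulr_ge0 ?oppr_ge0 ?(ltW alt0)// ?subr_ge0// (le_trans ler01).
  by move=> ? ?; lra.
split => //; have [a_0|a_neq0] := eqVneq a 0; last first.
  have agt0 : 0 < a by rewrite lt_def a_neq0.
  have := H (- b / a).
  rewrite (_ : _ + _ + _ = (a * c - b ^+ 2) / a); last by field.
  by rewrite pmulr_lge0 ?invr_gt0// subr_ge0.
suff -> : b = 0 by rewrite a_0 expr0n mul0r.
(* With [a = 0] the polynomial is linear, and at this point it takes the value [-1]. *)
apply/eqP/negPn/negP => b0; have := H (- (c + 1) / (2 * b)).
by rewrite a_0 mul0r add0r mulrCA divff ?mulf_neq0// mulr1; lra.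
Qed.

Section affine.
Context {R : realType}.

Definition affine {d : nat} (f : Rd R d -> R) : Prop :=
  exists (c : 'I_d -> R) (e : R), forall u, f u = \sum_i c i * tnth u i + e.

Lemma affine_comb d (f g : Rd R d -> R) (a b : R) :
  affine f -> affine g -> affine (fun u => a * f u + b * g u).
Proof.
move=> [c [e fE]] [c' [e' gE]].
exists (fun i => a * c i + b * c' i), (a * e + b * e') => u.
rewrite fE gE !mulrDr !mulr_sumr addrACA; congr (_ + _).
by rewrite -big_split/=; apply: eq_bigr => i _; ring.
Qed.

Lemma affine_cst d (a : R) : affine (fun _ : Rd R d => a).
Proof.
by exists (fun=> 0), a => u; rewrite big1 ?add0r// => i _; rewrite mul0r.
Qed.

Lemma affine_cons d (f : Rd R d.+1 -> R) : affine f ->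
  exists (a : R) (g : Rd R d -> R), affine g /\
    forall (h : R) (u : Rd R d), f [tuple of h :: u] = a * h + g u.
Proof.
move=> [c [e fE]]; exists (c ord0).
exists (fun u => \sum_i c (lift ord0 i) * tnth u i + e); split.
  by exists (fun i => c (lift ord0 i)), e.
move=> h u; rewrite fE big_ord_recl -addrA tnth0; congr (_ + (_ + _)).
by apply: eq_bigr => i _; rewrite tnthS.
Qed.

Lemma measurable_affine d (f : Rd R d -> R) :
  affine f -> measurable_fun [set: Rd R d] f.
Proof.
move=> [c [e fE]]; rewrite (_ : f = fun u => \sum_i c i * tnth u i + e).
  apply: measurable_funD => //; apply: measurable_sum => i.
  by apply: measurable_funM => //; exact: measurable_tnth.
exact/funext.
Qed.

End affine.

Section gauss_form.
Context {R : realType}.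

(* A positive definite quadratic polynomial in triangular (completed square)
   form; D is its determinant. *)
Fixpoint gauss_form d : (Rd R d -> R) -> R -> Prop :=
  match d with
  | 0%N => fun Q D => (forall u, Q u = 0) /\ D = 1
  | d'.+1 => fun Q D => exists (a : R) (f Q' : Rd R d' -> R) (D' : R),
      [/\ 0 < a, affine f, @gauss_form d' Q' D', D = a * D' &
      forall (h : R) (u : Rd R d'), Q [tuple of h :: u] = a * (h - f u) ^+ 2 + Q' u]
  end.
Arguments gauss_form : clear implicits.

Lemma gauss_form_gt0 d (Q : Rd R d -> R) D : gauss_form d Q D -> 0 < D.
Proof.
elim: d Q D => [|d IH] Q D /=; first by case=> _ ->.
by move=> [a [f [Q' [D' [a0 _ /IH D'0 -> _]]]]]; rewrite mulr_gt0.
Qed.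

Lemma measurable_gauss_form d (Q : Rd R d -> R) D :
  gauss_form d Q D -> measurable_fun [set: Rd R d] Q.
Proof.
elim: d Q D => [|d IH] Q D /=.
  by case=> Q0 _; rewrite (_ : Q = cst 0)//; apply/funext => u; rewrite Q0.
move=> [a [f [Q' [D' [a0 /measurable_affine mf /IH mQ' _ QE]]]]].
pose b (u : Rd R d.+1) : Rd R d := [tuple of behead u].
have mb : measurable_fun [set: Rd R d.+1] b by exact: measurable_behead.
rewrite (_ : Q = fun u => a * (tnth u ord0 - f (b u)) ^+ 2 + Q' (b u)); last first.
  apply/funext => u; case/tupleP: u => h u; rewrite QE tnth0.
  by rewrite (_ : b _ = u)//; exact: val_inj.
apply: measurable_funD; last exact: (measurableT_comp mQ' mb).
apply: measurable_funM => //; apply: measurable_funX.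
apply: measurable_funB; first exact: measurable_tnth.
exact: (measurableT_comp mf mb).
Qed.

Lemma gauss_form_diag d (w c : 'I_d -> R) : (forall i, 0 < w i) ->
  gauss_form d (fun u => \sum_i w i * (tnth u i - c i) ^+ 2) (\prod_i w i).
Proof.
elim: d w c => [|d IH] w c w0 /=.
  by split; rewrite ?big_ord0// => u; rewrite big_ord0.
exists (w ord0), (fun=> c ord0),
  (fun u => \sum_i w (lift ord0 i) * (tnth u i - c (lift ord0 i)) ^+ 2),
  (\prod_i w (lift ord0 i)); split => //.
- exact: affine_cst.
- exact: IH.
- by rewrite big_ord_recl.
move=> h u; rewrite big_ord_recl tnth0; congr (_ + _).
by apply: eq_bigr => i _; rewrite tnthS.
Qed.

(* Matrix determinant lemma: det (Q + l l^T) = (1 + |l|^2_{Q^{-1}}) det Q. *)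
Lemma gauss_form_rank1 d (Q : Rd R d -> R) D l K :
  gauss_form d Q D -> affine l -> 0 <= K ->
  (forall u, l u ^+ 2 <= K * Q u) ->
  exists2 D', D' <= (1 + K) * D & gauss_form d (fun u => Q u + l u ^+ 2) D'.
Proof.
elim: d Q D l K => [|d IH] Q D l K.
  move=> [Q0 ->] _ K0 lQ; exists 1; first by rewrite mulr1 lerDl.
  split => // u; have := lQ u; rewrite Q0 mulr0 add0r => l0.
  by apply/eqP; rewrite eq_le l0 sqr_ge0.
move=> [a [f [Q' [D' [a0 af gQ' -> QE]]]]] al K0 lQ.
have [b [g [ag lE]]] := affine_cons al.
(* [m] is the value of [l] where the first square of [Q] vanishes, that is at [h = f u]. *)
pose m u := b * f u + 1 * g u.
have am : affine m by exact: affine_comb.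
have lE' h (u : Rd R d) : l [tuple of h :: u] = b * (h - f u) + m u.
  by rewrite lE /m; ring.
(* For fixed [u], [K * Q - l ^+ 2] is a nonnegative quadratic polynomial in [k = h - f u]; its
   leading coefficient and discriminant give both claims. *)
have discr (u : Rd R d) : 0 <= K * a - b ^+ 2 /\
    (b * m u) ^+ 2 <= (K * a - b ^+ 2) * (K * Q' u - m u ^+ 2).
  have := @quad_ge0_discr _ (K * a - b ^+ 2) (- (b * m u)) (K * Q' u - m u ^+ 2).
  rewrite sqrrN; apply => k.
  have := lQ [tuple of (k + f u) :: u]; rewrite lE' QE addrK -subr_ge0.
  by move/le_trans; apply; rewrite le_eqVlt; apply/orP; left; apply/eqP; ring.
have Kab : 0 <= K * a - b ^+ 2 by case: (discr [tuple of nseq d 0]).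
have ab0 : 0 < a + b ^+ 2 by rewrite ltr_wpDr// sqr_ge0.
have mQ' (u : Rd R d) : a * m u ^+ 2 <= (K * a - b ^+ 2) * Q' u.
  (* For [K > 0] the discriminant inequality is [K] times the goal; for [K = 0] both [b] and [m u]
     vanish. *)
  have [_] := discr u; move: K0; rewrite le_eqVlt => /predU1P[K_0|Kgt0].
    have b0 : b = 0.
      by apply/eqP; rewrite -sqrf_eq0 eq_le sqr_ge0 andbT; move: Kab; rewrite -K_0; lra.
    have := lQ [tuple of 0 :: u]; rewrite lE' -K_0 b0 mul0r add0r => m0 _.
    have -> : m u ^+ 2 = 0 by apply/eqP; rewrite eq_le sqr_ge0 andbT (le_trans m0)// mul0r.
    by rewrite mul0r expr0n subr0 mul0r mulr0.
  rewrite -subr_ge0 (_ : _ - _ = K * ((K * a - b ^+ 2) * Q' u - a * m u ^+ 2)); last by ring.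
  by rewrite pmulr_rge0// subr_ge0.
(* Completing the square in [a * x ^+ 2 + (b * x + m) ^+ 2] leaves the remainder
   [a / (a + b ^+ 2) * m ^+ 2 = (s * m) ^+ 2], a rank one update in one dimension less. *)
pose s := Num.sqrt (a / (a + b ^+ 2)).
have sE : s ^+ 2 = a / (a + b ^+ 2) by rewrite sqr_sqrtr// divr_ge0// ltW.
have am' : affine (fun u => s * m u + 0 * m u) by exact: affine_comb.
have [| u |D'' D''D' gQ''] := IH _ _ _ ((K * a - b ^+ 2) / (a + b ^+ 2)) gQ' am'.
- by rewrite divr_ge0// ltW.
- rewrite mul0r addr0 exprMn sE mulrAC [leRHS]mulrAC.
  by rewrite ler_pM2r ?invr_gt0.
exists ((a + b ^+ 2) * D'').
  (* The constant of the induction hypothesis is such that the product collapses to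
     [(1 + K) * (a * D')]. *)
  apply: (@le_trans _ _ ((a + b ^+ 2) * ((1 + (K * a - b ^+ 2) / (a + b ^+ 2)) * D'))).
    by rewrite ler_pM2l.
  by rewrite le_eqVlt; apply/orP; left; apply/eqP; field; rewrite gt_eqF.
exists (a + b ^+ 2), (fun u => 1 * f u + (- (b / (a + b ^+ 2))) * m u),
  (fun u => Q' u + (s * m u + 0 * m u) ^+ 2), D''; split => //.
  exact: affine_comb.
move=> h u; rewrite QE lE' mul0r addr0 exprMn sE.
by field; rewrite gt_eqF.
Qed.

(** Iterates the rank one update: the accumulated form only grows, so the bounds against the initial
    [Q] stay valid along the way. *)
Lemma gauss_form_rank (I : Type) (r : seq I) d (Q : Rd R d -> R) D
    (l : I -> Rd R d -> R) (K : I -> R) :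
  gauss_form d Q D -> (forall i, affine (l i)) -> (forall i, 0 <= K i) ->
  (forall i u, l i u ^+ 2 <= K i * Q u) ->
  exists2 D', D' <= (\prod_(i <- r) (1 + K i)) * D &
    gauss_form d (fun u => Q u + \sum_(i <- r) l i u ^+ 2) D'.
Proof.
move=> gQ al K0 lQ; elim: r => [|i r [D' D'D gQ']].
  exists D; first by rewrite big_nil mul1r.
  by under eq_fun do rewrite big_nil addr0.
have [|D'' D''D' gQ''] := gauss_form_rank1 gQ' (al i) (K0 i).
  move=> u; apply: (le_trans (lQ i u)); rewrite ler_wpM2l// lerDl.
  by apply: sumr_ge0 => j _; exact: sqr_ge0.
exists D''.
  by rewrite big_cons -mulrA (le_trans D''D')// ler_wpM2l// addr_ge0.
by under eq_fun do rewrite big_cons [X in _ + X]addrC addrA.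
Qed.

Lemma integral_gauss1 (a m : R) : 0 < a ->
  (\int[lebesgue_measure]_x (expR (- (a * (x - m) ^+ 2) / 2))%:E =
   (Num.sqrt (2 * pi) / Num.sqrt a)%:E)%E.
Proof.
move=> a0; set s := (Num.sqrt a)^-1.
have s0 : s != 0 by rewrite invr_eq0 gt_eqF// sqrtr_gt0.
have s2 : s ^+ 2 = a^-1 by rewrite exprVn sqr_sqrtr// ltW.
have pk0 := normal_peak_gt0 s0.
have pkE : normal_peak s = (Num.sqrt (2 * pi) / Num.sqrt a)^-1.
  rewrite /normal_peak s2; congr (_^-1).
  rewrite -mulr_natr mulrC mulrA mulrC mulrA sqrtrM; last by rewrite mulr_ge0// pi_ge0.
  by rewrite sqrtrV ?ltW// [pi * 2]mulrC.
have := @integral_normal_pdf R m s; rewrite normal_pdfE//.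
under eq_integral do rewrite EFinM.
rewrite ge0_integralZl//; last 3 first.
- apply/measurable_EFinP; exact: measurable_normal_fun.
- by move=> x _; rewrite lee_fin expR_ge0.
- by rewrite lee_fin ltW.
set J := integral _ _ _ => JE.
have -> : (Num.sqrt (2 * pi) / Num.sqrt a)%:E = ((normal_peak s)^-1)%:E.
  by rewrite pkE invrK.
transitivity J.
  apply: eq_integral => x _; congr (expR _)%:E; rewrite s2 -mulr_natr.
  by field; rewrite gt_eqF.
have : ((normal_peak s)^-1%:E * ((normal_peak s)%:E * J) = (normal_peak s)^-1%:E * 1)%E.
  by rewrite JE.
by rewrite muleA -EFinM mulVf ?gt_eqF// mul1e mule1.
Qed.

(** In triangular form the head coordinate integrates to [sqrt (2 * pi / a)] whatever its centre
    [f u], so the pivots multiply up to [D]. *)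
Lemma integral_gauss_form d (Q : Rd R d -> R) D : gauss_form d Q D ->
  (\int[lebesgue_Rd R d]_u (expR (- Q u / 2))%:E =
   (Num.sqrt (2 * pi) ^+ d / Num.sqrt D)%:E)%E.
Proof.
elim: d Q D => [|d IH] Q D gQ; have mQ := measurable_gauss_form gQ.
  rewrite /lebesgue_Rd integral_tuple0; last first.
    apply/measurable_EFinP/measurableT_comp => //.
    by apply: measurable_funM => //; exact: measurableT_comp.
  by case: gQ => -> ->; rewrite oppr0 mul0r expR0 sqrtr1 expr0 divr1.
rewrite /lebesgue_Rd integral_tupleS_sym; last 2 first.
- apply/measurable_EFinP/measurableT_comp => //.
  by apply: measurable_funM => //; exact: measurableT_comp.
- by move=> u; rewrite lee_fin expR_ge0.
move: gQ => [a [f [Q' [D' [a0 af gQ' -> QE]]]]].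
have mQ' := measurable_gauss_form gQ'.
transitivity (\int[lebesgue_Rd R d]_u
   ((expR (- Q' u / 2))%:E * (Num.sqrt (2 * pi) / Num.sqrt a)%:E))%E.
  apply: eq_integral => u _; rewrite -(integral_gauss1 (f u) a0).
  rewrite -ge0_integralZl//; last first.
    apply/measurable_EFinP/measurableT_comp => //; apply: measurable_funM => //.
    apply: measurableT_comp => //; apply: measurable_funM => //.
    by apply: measurable_funX; apply: measurable_funB.
  apply: eq_integral => h _; rewrite QE -EFinM -expRD; congr (expR _)%:E.
  by field.
rewrite ge0_integralZr//; last first.
  apply/measurable_EFinP/measurableT_comp => //.
  by apply: measurable_funM => //; exact: measurableT_comp.
rewrite (IH _ _ gQ') -EFinM exprSr (sqrtrM D' (ltW a0)); congr (_%:E).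
by rewrite mulf_div [X in _ / X]mulrC.
Qed.

End gauss_form.
Arguments gauss_form {R} d Q D.

(** * Lower bound on the evidence *)

(** Discriminant of the nonnegative polynomial [\sum_i (x i * k + u i) ^+ 2] in [k]. *)
Lemma dot_cauchy_schwarz {R : realType} {d : nat} (x u : 'I_d -> R) :
  (\sum_i x i * u i) ^+ 2 <= (\sum_i x i ^+ 2) * (\sum_i u i ^+ 2).
Proof.
apply: (proj2 (quad_ge0_discr _)) => k.
rewrite mulr_suml !mulr_sumr mulr_suml -!big_split/=; apply: sumr_ge0 => i _.
by rewrite (_ : _ + _ + _ = (x i * k + u i) ^+ 2) ?sqr_ge0//; ring.
Qed.

Section logistic_bounds.
Context {R : realType} {d : nat}.

Lemma logistic_gt0 (theta : Rd R d) y x : 0 < logistic theta y x.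
Proof. by rewrite divr_gt0 ?addr_gt0 ?expR_gt0. Qed.

Lemma logistic_le1 (theta : Rd R d) y x : logistic theta y x <= 1.
Proof.
by rewrite ler_pdivrMr ?addr_gt0 ?expR_gt0// mul1r lerDr.
Qed.

(** The logarithm of [expR u / (1 + expR u)] is 1-Lipschitz in [u], and the label has absolute value
    1. *)
Lemma logistic_ratio_ge (theta theta0 : Rd R d) y x :
  expR (- `|dot x theta - dot x theta0|) <=
  logistic theta y x / logistic theta0 y x.
Proof.
rewrite ler_pdivlMr ?logistic_gt0// /logistic.
rewrite -[X in - X](_ : `|label R y * dot x theta - label R y * dot x theta0| = _);
  last by rewrite -mulrBr normrM; case: y; rewrite /label ?normrN normr1 mul1r.
set u := _ * dot x theta; set v := _ * dot x theta0.
have eu := expR_gt0 u; have ev := expR_gt0 v.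
rewrite mulrA ler_pdivrMr ?addr_gt0// mulrAC ler_pdivlMr ?addr_gt0//.
have [uv|vu] := leP v u.
  have e1 : expR (- (u - v)) <= 1 by rewrite -expR0 ler_expR oppr_le0 subr_ge0.
  have -> : `|u - v| = u - v by rewrite ger0_norm ?subr_ge0.
  have euv : expR v <= expR u by rewrite ler_expR.
  apply: (@le_trans _ _ (expR v * (1 + expR u))).
    by rewrite ler_pM2r ?addr_gt0// ler_piMl// ltW.
  by rewrite !mulrDr !mulr1 [expR u * _]mulrC lerD2r.
have -> : `|u - v| = v - u by rewrite distrC ger0_norm// subr_ge0 ltW.
rewrite opprB -expRD subrK ler_pM2l// lerD2l ler_expR; exact: ltW.
Qed.

(** Since [(1 + t)^-1 <= expR (- (t / (1 + t)))], it suffices that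
    [t / (1 + t) + (1 + t) / (2 * t) * y ^+ 2] dominates the absolute value of [y], which follows by
    completing the square. At [t = 0] the quotient [(1 + t) / t] is 0 by convention. *)
Lemma expRN_abs_ge (t y : R) : 0 <= t -> (t = 0 -> y = 0) ->
  (1 + t)^-1 * expR (- ((1 + t) / t * y ^+ 2) / 2) <= expR (- `|y|).
Proof.
rewrite le_eqVlt => /predU1P[<- /(_ erefl)->|t0 _].
  by rewrite normr0 oppr0 expr0n/= mulr0 oppr0 mul0r expR0 addr0 invr1 mul1r.
apply: (@le_trans _ _ (expR (- (t / (1 + t))) *
    expR (- ((1 + t) / t * y ^+ 2) / 2))).
  rewrite ler_pM2r ?expR_gt0//; apply: le_trans (expR_ge1Dx _).
  by rewrite le_eqVlt; apply/orP; left; apply/eqP; field; rewrite gt_eqF//; lra.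
rewrite -expRD ler_expR -subr_ge0.
have -> : y ^+ 2 = `|y| ^+ 2 by rewrite real_normK// num_real.
rewrite (_ : _ - _ = t / (2 * (1 + t)) +
  ((1 + t) / (2 * t)) * (`|y| - t / (1 + t)) ^+ 2); last first.
  by field; rewrite !gt_eqF//; lra.
apply: addr_ge0; first by apply: divr_ge0; lra.
by apply: mulr_ge0; [apply: divr_ge0; lra|exact: sqr_ge0].
Qed.

(* The data enter only through (1 + |x_i| / N): since the Gaussian weight has
   standard deviation at most 1 / N in every direction, each datum costs only
   logarithmically in |x_i|. *)
Lemma gauss_evidence_ge {n : nat} (x : 'I_n -> Rd R d) (theta0 : Rd R d)
    (w : 'I_d -> R) (N : R) : 0 < N -> (forall j, N ^+ 2 <= w j) ->
  ((Num.sqrt (2 * pi) ^+ d / Num.sqrt (\prod_j w j) /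
     (\prod_i (1 + norm2 (x i) / N)) ^+ 2)%:E <=
  \int[lebesgue_Rd R d]_theta
    (expR (- (\sum_j w j * (tnth theta j - tnth theta0 j) ^+ 2) / 2) *
     \prod_i expR (- `|dot (x i) theta - dot (x i) theta0|))%:E)%E.
Proof.
move=> N0 Nw.
have w0 j : 0 < w j by apply: lt_le_trans (Nw j); rewrite exprn_gt0.
pose Q (theta : Rd R d) := \sum_j w j * (tnth theta j - tnth theta0 j) ^+ 2.
have gQ : gauss_form d Q (\prod_j w j) by exact: gauss_form_diag.
pose t i := norm2 (x i) / N.
have t0 i : 0 <= t i by rewrite divr_ge0 ?sqrtr_ge0// ltW.
pose y i (theta : Rd R d) := dot (x i) theta - dot (x i) theta0.
(* Cauchy-Schwarz, then [N ^+ 2 <= w j] to pass from the Euclidean norm to [Q]. *)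
have y2 i theta : y i theta ^+ 2 <= t i ^+ 2 * Q theta.
  have -> : y i theta =
      \sum_j (tnth (x i) j : R) * (tnth theta j - tnth theta0 j).
    by rewrite /y /dot -sumrB; apply: eq_bigr => j _; rewrite mulrBr.
  apply: (le_trans (dot_cauchy_schwarz _ _)).
  rewrite exprMn /norm2 sqr_sqrtr; last by apply: sumr_ge0 => j _; exact: sqr_ge0.
  rewrite -mulrA ler_wpM2l//; first by apply: sumr_ge0 => j _; exact: sqr_ge0.
  rewrite exprVn ler_pdivlMl ?exprn_gt0// mulr_sumr; apply: ler_sum => j _.
  by rewrite ler_wpM2r ?sqr_ge0.
have t_eq0 i theta : t i = 0 -> y i theta = 0.
  move=> ti0; apply/eqP; rewrite -sqrf_eq0 eq_le sqr_ge0 andbT.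
  by have := y2 i theta; rewrite ti0 expr0n mul0r.
(* Scaled so that [l i ^+ 2] is the quadratic exponent of [expRN_abs_ge]; by [y2] it is at most
   [(1 + t i) * t i] times [Q]. *)
pose l i (theta : Rd R d) := Num.sqrt ((1 + t i) / t i) * y i theta.
have l2 i theta : l i theta ^+ 2 = (1 + t i) / t i * y i theta ^+ 2.
  by rewrite exprMn sqr_sqrtr// divr_ge0// addr_ge0.
have al i : affine (l i).
  exists (fun j => Num.sqrt ((1 + t i) / t i) * (tnth (x i) j : R)),
    (- Num.sqrt ((1 + t i) / t i) * dot (x i) theta0) => theta.
  rewrite /l /y mulrBr mulNr; congr (_ - _).
  by rewrite mulr_sumr; apply: eq_bigr => j _; rewrite mulrA.
have [||D' D'le gQ'] := @gauss_form_rank R _ (index_enum 'I_n) d Q _ l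
    (fun i => (1 + t i) * t i) gQ al.
- by move=> i; rewrite mulr_ge0// addr_ge0.
- move=> i theta; rewrite l2; have [ti0|ti0] := eqVneq (t i) 0.
    by rewrite t_eq0// expr0n mulr0 ti0 mulr0 mul0r.
  apply: (@le_trans _ _ ((1 + t i) / t i * (t i ^+ 2 * Q theta))).
    by rewrite ler_wpM2l// divr_ge0// addr_ge0.
  by rewrite le_eqVlt; apply/orP; left; apply/eqP; field.
pose W := \prod_i (1 + t i).
have W0 : 0 < W by apply: prodr_gt0 => i _; exact: ltr_wpDr (t0 i) ltr01.
(* Uses [1 + (1 + t) * t <= (1 + t) ^+ 2]. After the square root this costs one factor [W]; the
   prefactors of [expRN_abs_ge] cost the other. *)
have D'W : D' <= W ^+ 2 * \prod_j w j.
  apply: (le_trans D'le); rewrite ler_wpM2r//.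
    by apply: prodr_ge0 => j _; exact: ltW.
  rewrite -prodrXl; apply: ler_prod => i _.
  by move: (t i) (t0 i) => s s0; apply/andP; split; nra.
have D'0 := gauss_form_gt0 gQ'.
have P0 : 0 < \prod_j w j by exact: prodr_gt0.
apply: (@le_trans _ _ (\int[lebesgue_Rd R d]_theta ((W^-1)%:E *
   (expR (- (Q theta + \sum_i l i theta ^+ 2) / 2))%:E))%E).
  have mQ' := measurable_gauss_form gQ'.
  rewrite ge0_integralZl//; last 2 first.
  - apply/measurable_EFinP/measurableT_comp => //.
    by apply: measurable_funM => //; exact: measurableT_comp.
  - by rewrite lee_fin invr_ge0 ltW.
  rewrite (integral_gauss_form gQ') -EFinM lee_fin -/W.
  rewrite [leRHS]mulrC -!mulrA ler_wpM2l ?exprn_ge0//.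
  rewrite expr2 invfM mulrA ler_pM2r ?invr_gt0//.
  rewrite -invfM lef_pV2 ?posrE ?mulr_gt0 ?sqrtr_gt0//.
  have -> : Num.sqrt (\prod_j w j) * W = Num.sqrt (W ^+ 2 * \prod_j w j).
    by rewrite sqrtrM ?sqr_ge0// sqrtr_sqr gtr0_norm// mulrC.
  exact: ler_wsqrtr.
apply: ge0_le_integral => //.
- by move=> theta _; rewrite mule_ge0// lee_fin ?expR_ge0// invr_ge0 ltW.
- apply: emeasurable_funM => //; apply/measurable_EFinP/measurableT_comp => //.
  have mQ' := measurable_gauss_form gQ'.
  by apply: measurable_funM => //; exact: measurableT_comp.
- apply/measurable_EFinP/measurable_funM.
    apply: measurableT_comp => //; apply: measurable_funM => //.
    apply: measurableT_comp => //; exact: (measurable_gauss_form gQ).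
  apply: measurable_prod => i _; apply: measurableT_comp => //.
  apply: measurableT_comp => //; apply: measurableT_comp => //.
  apply: measurable_affine.
  by exists (fun j => (tnth (x i) j : R)), (- dot (x i) theta0) => theta.
move=> theta _; rewrite -EFinM lee_fin -/(Q theta).
rewrite opprD mulrDl expRD mulrCA ler_wpM2l ?expR_ge0//.
rewrite -sumrN mulr_suml expR_sum /W -prodfV -big_split/=.
apply: ler_prod => i _; rewrite mulr_ge0 ?expR_ge0 ?invr_ge0 ?addr_ge0//=.
by rewrite l2; apply: expRN_abs_ge => // /t_eq0.
Qed.

End logistic_bounds.

(** * Gaussian minorant of the spike and slab density *)

Section prior_bounds.
Context {R : realType}.

Lemma normal_pdf_centered (v x : R) : 0 < v ->
  normal_pdf 0 (Num.sqrt v) x =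
  (Num.sqrt (2 * pi))^-1 * (Num.sqrt v)^-1 * expR (- (x ^+ 2 / v) / 2).
Proof.
move=> v0; have sv : Num.sqrt v != 0 by rewrite gt_eqF// sqrtr_gt0.
rewrite normal_pdfE// /normal_peak /normal_fun sqr_sqrtr ?ltW//; congr (_ * _).
  rewrite -invfM -mulr_natr -mulrA [pi * 2]mulrC [v * _]mulrC.
  by rewrite sqrtrM// mulr_ge0 ?pi_ge0.
by congr expR; rewrite subr0 -mulr_natr; field; rewrite gt_eqF.
Qed.

(** From [x ^+ 2 + (x - 2 * c) ^+ 2 = 2 * c ^+ 2 + 2 * (x - c) ^+ 2], the slab can be recentred at
    [c] at the price [expR (- (c ^+ 2 / v1))] and of doubling its precision, and
    [2 / v1 <= (N / k) ^+ 2]. *)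
Lemma slab_pdf_ge (p v1 k N c x : R) : 0 <= p -> 0 < v1 -> 0 < k ->
  2 * k ^+ 2 <= v1 -> 1 <= N ->
  p / Num.sqrt v1 * expR (- (c ^+ 2 / v1)) / Num.sqrt (2 * pi) *
    expR (- ((N / k) ^+ 2 * (x - c) ^+ 2) / 2) <=
  p * normal_pdf 0 (Num.sqrt v1) x.
Proof.
move=> p0 v10 k0 kv1 N1; rewrite normal_pdf_centered//.
set e := Num.sqrt (2 * pi).
rewrite (_ : _ * _ = p * (e^-1 * (Num.sqrt v1)^-1 *
  (expR (- (c ^+ 2 / v1)) * expR (- ((N / k) ^+ 2 * (x - c) ^+ 2) / 2)))); last by ring.
rewrite ler_wpM2l// ler_wpM2l ?mulr_ge0 ?invr_ge0 ?sqrtr_ge0//.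
rewrite -expRD ler_expR.
have kN : 2 / v1 <= (N / k) ^+ 2.
  rewrite exprMn exprVn ler_pdivrMr// mulrAC ler_pdivlMr ?exprn_gt0//.
  apply: (le_trans kv1); apply: ler_peMl; first exact: ltW.
  exact: exprn_ege1.
have := ler_wpM2r (sqr_ge0 (x - c)) kN.
have : 0 <= (x - 2 * c) ^+ 2 / v1 by rewrite divr_ge0 ?sqr_ge0 ?ltW.
rewrite (_ : 2 / v1 * (x - c) ^+ 2 =
  x ^+ 2 / v1 - 2 * (c ^+ 2 / v1) + (x - 2 * c) ^+ 2 / v1); last first.
  by field; rewrite gt_eqF.
set A := x ^+ 2 / v1; set C := c ^+ 2 / v1; set B := _ ^+ 2 / v1; lra.
Qed.

(** [expR (1 / d) >= 1 + 1 / d] gives the intermediate bound [1 / (1 + d)]. So the slab weight [p]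
    is at least of order [1 / d]. *)
Lemma one_sub_expRN_ge (d : nat) : (0 < d)%N ->
  (2 * d%:R)^-1 <= 1 - expR (- (1 / d%:R)) :> R.
Proof.
move=> d0; have d1 : 1 <= d%:R :> R by rewrite ler1n.
have e1 := @expR_ge1Dx R (1 / d%:R).
have dp : 0 < 1 / d%:R :> R by rewrite divr_gt0//; lra.
rewrite expRN; have : (expR (1 / d%:R))^-1 <= (1 + 1 / d%:R)^-1 :> R.
  by rewrite lef_pV2// posrE ?expR_gt0//; lra.
suff : (2 * d%:R)^-1 <= 1 - (1 + 1 / d%:R)^-1 :> R by lra.
have -> : 1 - (1 + 1 / d%:R)^-1 = (1 + d%:R)^-1 :> R.
  by field; rewrite !gt_eqF//; lra.
by rewrite lef_pV2// ?posrE; lra.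
Qed.

(** In each coordinate one mixture component is kept: the slab, recentred and narrowed to deviation
    [k / n], where [theta0] is nonzero, and the spike elsewhere. *)
Lemma spike_slab_pdf_mass_ge (n d : nat) (theta0 : Rd R d) (p : {i01 R})
    (v0 v1 k : R) :
  let w (j : 'I_d) := if (tnth theta0 j : R) != 0 then (n%:R / k) ^+ 2 else v0^-1 in
  (0 < n)%N -> (0 < d)%N -> 0 < v0 -> 0 < v1 -> 0 < k -> 2 * k ^+ 2 <= v1 ->
  p%:num = 1 - expR (- (1 / d%:R)) ->
  forall theta : Rd R d,
  expR (- (1 + norm2 theta0 ^+ 2 / v1)) *
    (k / (2 * (n%:R * d%:R) * Num.sqrt v1)) ^+ norm0 theta0 *
    (Num.sqrt (\prod_j w j) / Num.sqrt (2 * pi) ^+ d) *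
    expR (- (\sum_j w j * (tnth theta j - tnth theta0 j) ^+ 2) / 2) <=
  spike_slab_pdf p v0 v1 theta.
Proof.
move=> w n0 d0 v00 v10 k0 kv1 pE theta.
have n1 : 1 <= n%:R :> R by rewrite ler1n.
have d1 : 1 <= d%:R :> R by rewrite ler1n.
have w0 j : 0 < w j.
  rewrite /w; case: ifP => _; last by rewrite invr_gt0.
  by rewrite exprn_gt0// divr_gt0//; lra.
have sv1 : 0 < Num.sqrt v1 by rewrite sqrtr_gt0.
set rho := k / _.
(* [expR (- (1 / d))] is the spike weight [1 - p]; it is also inserted on the support, where it only
   decreases the bound, so that the [d] copies multiply to [expR (- 1)]. *)
pose b (j : 'I_d) : R := expR (- (1 / d%:R) - (tnth theta0 j : R) ^+ 2 / v1) *
  (if (tnth theta0 j : R) != 0 then rho else 1).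
have -> : expR (- (1 + norm2 theta0 ^+ 2 / v1)) * rho ^+ norm0 theta0 =
    \prod_j b j.
  rewrite big_split/= -big_mkcond/= prodr_const -expR_sum; congr (expR _ * rho ^+ _).
    rewrite opprD big_split/=; congr (_ + _).
      by rewrite sumr_const card_ord -mulr_natr; field; rewrite gt_eqF//; lra.
    rewrite /norm2 sqr_sqrtr; last by apply: sumr_ge0 => j _; exact: sqr_ge0.
    by rewrite mulr_suml sumrN.
  by rewrite /norm0 cardsE.
have -> : Num.sqrt (\prod_j w j) / Num.sqrt (2 * pi) ^+ d =
    \prod_j (Num.sqrt (w j) / Num.sqrt (2 * pi)).
  rewrite big_split/= prodr_const card_ord exprVn; congr (_ / _).
  elim/big_rec2: _ => [|j x y _ <-]; first by rewrite sqrtr1.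
  by rewrite sqrtrM// ltW.
rewrite -sumrN mulr_suml expR_sum -!big_split/=.
apply: ler_prod => j _; apply/andP; split.
  rewrite !mulr_ge0 ?expR_ge0 ?invr_ge0 ?sqrtr_ge0//.
  by case: ifP => // _; rewrite divr_ge0 ?mulr_ge0 ?sqrtr_ge0// ltW.
have pd := one_sub_expRN_ge d0; rewrite -pE in pd.
have p0 : 0 <= p%:num by [].
have qE : 1 - p%:num = expR (- (1 / d%:R)) by rewrite pE; ring.
rewrite /b /w; case: ifPn => [c0|]; last first.
  rewrite negbK => /eqP ->; rewrite expr0n/= mul0r !subr0 mulr1.
  apply: ler_wpDl; first by rewrite mulr_ge0// normal_pdf_ge0.
  rewrite normal_pdf_centered// qE (sqrtrV (ltW v00)) !mulrA le_eqVlt; apply/orP; left.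
  apply/eqP; congr (_ * expR _); last by ring.
  by rewrite mulrAC.
apply: ler_wpDr.
  by rewrite mulr_ge0 ?normal_pdf_ge0// qE expR_ge0.
apply: le_trans (@slab_pdf_ge _ v1 k n%:R (tnth theta0 j) _ p0 v10 k0 kv1 n1).
rewrite ler_wpM2r ?expR_ge0// mulrA ler_wpM2r ?invr_ge0 ?sqrtr_ge0//.
have nk0 : 0 <= n%:R / k by rewrite divr_ge0//; lra.
rewrite sqrtr_sqr ger0_norm// expRD.
rewrite [leLHS](_ : _ = (expR (- (1 / d%:R)) * (2 * d%:R)^-1) / Num.sqrt v1 *
   expR (- ((tnth theta0 j : R) ^+ 2 / v1))); last first.
  by rewrite /rho; field; rewrite !gt_eqF//; lra.
rewrite ler_wpM2r ?expR_ge0// ler_wpM2r ?invr_ge0 ?sqrtr_ge0//.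
by apply: le_trans pd; rewrite ler_piMl.
Qed.

Lemma likelihood_gt0 (n d : nat) (z : n.-tuple (bool * Rd R d)) theta :
  0 < likelihood z theta.
Proof. by apply: prodr_gt0 => i _; exact: logistic_gt0. Qed.

Lemma likelihood_le1 (n d : nat) (z : n.-tuple (bool * Rd R d)) theta :
  likelihood z theta <= 1.
Proof.
apply: (@le_trans _ _ (\prod_(i < n) 1)); last by rewrite big1.
by apply: ler_prod => i _; rewrite ltW ?logistic_gt0 ?logistic_le1.
Qed.

Lemma measurable_likelihood_ratio (n d : nat) (z : n.-tuple (bool * Rd R d))
    (theta0 : Rd R d) (a : R) :
  measurable_fun [set: Rd R d]
    (fun theta => (likelihood z theta / likelihood z theta0) `^ a).
Proof.
apply: (measurableT_comp (measurable_powR a)).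
apply: measurable_funM => //.
by apply: measurable_prod => i _; apply: measurable_logistic.
Qed.

(** The normalization [C] of the Gaussian minorant of the prior cancels against the Gaussian
    integral of [gauss_evidence_ge]. The bound on [v0] serves the precisions [v0^-1] of the zero
    coordinates, hence its guard. *)
Lemma evidence_ge (n d : nat) (z : n.-tuple (bool * Rd R d))
    (theta0 : Rd R d) (p : {i01 R}) (v0 v1 k a : R) :
  (0 < n)%N -> (0 < d)%N -> 0 < v1 -> 0 < k -> 2 * k ^+ 2 <= v1 ->
  p%:num = 1 - expR (- (1 / d%:R)) -> k <= 1 -> 0 < v0 ->
  ([exists j, (tnth theta0 j : R) == 0] -> n%:R ^+ 2 * v0 <= 1) ->
  0 < a < 1 ->
  ((expR (- (1 + norm2 theta0 ^+ 2 / v1)) *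
    (k / (2 * (n%:R * d%:R) * Num.sqrt v1)) ^+ norm0 theta0 /
    (\prod_(i < n) (1 + norm2 (tnth z i).2 / n%:R)) ^+ 2)%:E <=
  \int[lebesgue_Rd R d]_theta
    ((likelihood z theta / likelihood z theta0) `^ a *
     spike_slab_pdf p v0 v1 theta)%:E)%E.
Proof.
move=> n0 d0 v10 k0 kv1 pE k1 v00 nv0 /andP[a0 a1].
have n1 : 1 <= n%:R :> R by rewrite ler1n.
pose w (j : 'I_d) := if (tnth theta0 j : R) != 0 then (n%:R / k) ^+ 2 else v0^-1.
have nw j : n%:R ^+ 2 <= w j.
  rewrite /w; case: ifPn => [_|].
    have nk : n%:R <= n%:R / k by rewrite ler_pdivlMr// ler_piMr.
    by apply: lerXn2r; rewrite ?nnegrE ?divr_ge0 // ltW.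
  rewrite negbK => c0; rewrite -[leRHS]mul1r ler_pdivlMr//; apply: nv0.
  by apply/existsP; exists j.
have w0 j : 0 < w j by apply: lt_le_trans (nw j); rewrite exprn_gt0//; lra.
have n_gt0 : 0 < n%:R :> R by lra.
set B := expR _ * _.
have B0 : 0 <= B.
  by rewrite mulr_ge0 ?expR_ge0// exprn_ge0// divr_ge0 ?(ltW k0).
have sP : 0 < Num.sqrt (2 * pi) :> R by rewrite sqrtr_gt0 mulr_gt0 ?pi_gt0.
have sW : 0 < Num.sqrt (\prod_j w j) by rewrite sqrtr_gt0 prodr_gt0.
set C := Num.sqrt (\prod_j w j) / Num.sqrt (2 * pi) ^+ d.
have C0 : 0 < C by rewrite divr_gt0// exprn_gt0.
have := @gauss_evidence_ge R d n (fun i => (tnth z i).2) theta0 w n%:R n_gt0 nw.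
set W := (\prod_i _) ^+ 2; set J := integral _ _ _ => WJ.
apply: (@le_trans _ _ ((B * C)%:E * J)%E).
  apply: le_trans (lee_wpmul2l _ WJ); last by rewrite lee_fin mulr_ge0// ltW.
  rewrite -EFinM lee_fin le_eqVlt; apply/orP; left; apply/eqP.
  rewrite mulrA; congr (_ / _); rewrite -mulrA -[LHS]mulr1; congr (_ * _).
  by rewrite /C mulrA divfK ?divff ?gt_eqF// exprn_gt0.
have mJ : measurable_fun [set: Rd R d] (fun theta : Rd R d =>
    (expR (- (\sum_j w j * (tnth theta j - tnth theta0 j) ^+ 2) / 2) *
     \prod_(i < n) expR (- `|dot (tnth z i).2 theta - dot (tnth z i).2 theta0|))%:E).
  apply/measurable_EFinP/measurable_funM.
    apply: measurableT_comp => //; apply: measurable_funM => //.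
    apply: measurableT_comp => //.
    exact: (measurable_gauss_form (gauss_form_diag (fun j => tnth theta0 j) w0)).
  apply: measurable_prod => i _; apply: measurableT_comp => //.
  apply: measurableT_comp => //; apply: measurableT_comp => //.
  apply: measurable_affine.
  by exists (fun j => (tnth (tnth z i).2 j : R)), (- dot (tnth z i).2 theta0) => theta.
rewrite -ge0_integralZl//; last 2 first.
- by move=> theta _; rewrite lee_fin mulr_ge0 ?expR_ge0// prodr_ge0// => i _; exact: expR_ge0.
- by rewrite lee_fin mulr_ge0// ltW.
apply: ge0_le_integral => //.
- move=> theta _; rewrite mule_ge0// lee_fin; first by rewrite mulr_ge0// ltW.
  by rewrite mulr_ge0 ?expR_ge0// prodr_ge0// => i _; exact: expR_ge0.
- exact: emeasurable_funM.
- apply/measurable_EFinP/measurable_funM; first exact: measurable_likelihood_ratio.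
  by apply/measurable_EFinP; exact: measurable_spike_slab_pdf.
move=> theta _; rewrite -EFinM lee_fin mulrA mulrC.
apply: ler_pM.
- by rewrite prodr_ge0// => i _; exact: expR_ge0.
- exact: mulr_ge0 (mulr_ge0 B0 (ltW C0)) (expR_ge0 _).
- set r := likelihood z theta / likelihood z theta0.
  have rge : \prod_(i < n) expR (- `|dot (tnth z i).2 theta - dot (tnth z i).2 theta0|) <= r.
    rewrite /r /likelihood -prodf_div; apply: ler_prod => i _.
    by rewrite expR_ge0/= logistic_ratio_ge.
  move: rge; rewrite -expR_sum sumrN => rge.
  set s := \sum_(i < n) _ in rge *.
  have s0 : 0 <= s by apply: sumr_ge0.
  (* The exponent [a] is absorbed: [a * s <= s] because [0 <= s] and [a < 1]. *)
  apply: (@le_trans _ _ (expR (- s) `^ a)); last first.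
    have r0 : 0 < r by rewrite divr_gt0 ?likelihood_gt0.
    by apply: (ge0_ler_powR (ltW a0) _ _ rge); rewrite nnegrE ?expR_ge0// ltW.
  by rewrite -expRM ler_expR mulNr lerN2 ler_piMr// ltW.
- exact: spike_slab_pdf_mass_ge.
Qed.

End prior_bounds.

(** * The logistic model and its Renyi divergence *)

Lemma markov_ge0 {d : measure_display} {T : measurableType d} {R : realType}
    (mu : {measure set T -> \bar R}) (f : T -> \bar R) (c : R) :
  measurable_fun [set: T] f -> (forall x, (0 <= f x)%E) -> 0 < c ->
  (mu [set x | (c%:E <= f x)%E] <= c^-1%:E * \int[mu]_x f x)%E.
Proof.
move=> mf f0 c0.
have := @le_integral_comp_abse _ _ R mu setT measurableT f c id
  (@measurable_id _ _ _) (fun=> id) (fun _ _ _ _ => id) mf c0.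
rewrite setTI /=.
rewrite (_ : [set x | (c%:E <= `|f x|)%E] = [set x | (c%:E <= f x)%E]); last first.
  by apply/seteqP; split => x /=; rewrite gee0_abs.
under eq_integral do rewrite gee0_abs//.
move=> H; by rewrite lee_pdivlMl.
Qed.

Lemma powR_prod {R : realType} (I : Type) (r : seq I) (f : I -> R) (a : R) :
  (forall i, 0 <= f i) -> (\prod_(i <- r) f i) `^ a = \prod_(i <- r) f i `^ a.
Proof.
move=> f0; elim: r => [|i r IH]; first by rewrite !big_nil powR1.
by rewrite !big_cons powRM ?IH//; exact: prodr_ge0.
Qed.

(** Concavity of [ln]: at [x] and [y] it lies below its tangent at the weighted mean [m], and the
    linear terms average out. *)
Lemma powR_young {R : realType} (a x y : R) : 0 < a < 1 -> 0 < x -> 0 < y ->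
  x `^ a * y `^ (1 - a) <= a * x + (1 - a) * y.
Proof.
move=> /andP[a0 a1] x0 y0; set m := a * x + (1 - a) * y.
have m0 : 0 < m by rewrite addr_gt0// mulr_gt0// subr_gt0.
have tangent u : 0 < u -> ln u <= ln m + u / m - 1.
  move=> u0; have := expR_ge1Dx (ln u - ln m).
  by rewrite expRD expRN !lnK ?posrE//; lra.
rewrite /powR !gt_eqF// -expRD -[leRHS]lnK ?posrE// ler_expR.
apply: (@le_trans _ _ (a * (ln m + x / m - 1) + (1 - a) * (ln m + y / m - 1))).
  by rewrite lerD// ler_pM2l// ?subr_gt0// tangent.
rewrite [leLHS](_ : _ = ln m + (m / m - 1)); last first.
  by set L := ln m; set i := m^-1; rewrite /m; ring.
by rewrite divff ?gt_eqF// subrr addr0.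
Qed.

Section model.
Context {R : realType} {d : nat}.
Variable PX : probability (Rd R d) R.

Lemma measurable_logistic_joint (e : measure_display) (T : measurableType e)
    (theta : T -> Rd R d) (z : T -> bool * Rd R d) :
  measurable_fun [set: T] theta -> measurable_fun [set: T] z ->
  measurable_fun [set: T] (fun t => logistic (theta t) (z t).1 (z t).2).
Proof.
move=> mt mz; apply: measurable_logistic => //.
  exact: (measurableT_comp measurable_snd mz).
exact: (measurableT_comp measurable_fst mz).
Qed.

Lemma measurable_logistic1 (theta : Rd R d) :
  measurable_fun [set: bool * Rd R d] (fun z => logistic theta z.1 z.2).
Proof. exact: (@measurable_logistic_joint _ _ (cst theta) id). Qed.

Lemma integral_logistic_law (theta : Rd R d) (f : bool * Rd R d -> \bar R) :
  measurable_fun setT f -> (forall z, (0 <= f z)%E) ->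
  (\int[logistic_law PX theta]_z f z =
   \int[logistic_base PX]_z (f z * logistic_pdf theta z))%E.
Proof.
move=> mf f0.
exact: (@ge0_integral_density _ _ _ (logistic_base PX) _
  (measurable_logistic_pdf theta) (logistic_pdf_ge0 theta) f mf f0 (fun=> erefl)).
Qed.

Lemma integral_logistic_base (f : bool * Rd R d -> \bar R) :
  measurable_fun setT f -> (forall z, (0 <= f z)%E) ->
  (\int[logistic_base PX]_z f z =
   \int[PX]_x (f (true, x) + f (false, x)))%E.
Proof.
move=> mf f0.
have mf2 y : measurable_fun setT (fun x => f (y, x)).
  exact: measurableT_comp.
have F0 y : (0 <= \int[PX]_x f (y, x))%E by exact: integral_ge0.
rewrite [LHS](@fubini_tonelli1 _ _ _ _ _ (label_counting R) PX f mf f0).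
rewrite ge0_integral_measure_add//=; last by move=> y _; exact: F0.
by rewrite !integral_dirac// !diracT !mul1e /fubini_F -ge0_integralD.
Qed.

(** The two label probabilities add up to 1, so the covariate has law [PX] under every [theta]. *)
Lemma integral_logistic_law_covariate (theta : Rd R d) (g : Rd R d -> R) :
  measurable_fun setT g -> (forall x, 0 <= g x) ->
  (\int[logistic_law PX theta]_z (g z.2)%:E = \int[PX]_x (g x)%:E)%E.
Proof.
move=> mg g0.
have mg2 : measurable_fun setT (fun z : bool * Rd R d => g z.2).
  exact: (measurableT_comp mg measurable_snd).
rewrite integral_logistic_law//; last 2 first.
- exact/measurable_EFinP.
- by move=> z; rewrite lee_fin.
rewrite integral_logistic_base//; last 2 first.
- by apply: emeasurable_funM; [exact/measurable_EFinP|exact: measurable_logistic_pdf].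
- by move=> z; rewrite mule_ge0 ?lee_fin//; exact: logistic_pdf_ge0.
apply: eq_integral => x _.
by rewrite /logistic_pdf/= -!EFinM -EFinD -mulrDr logistic_sum1 mulr1.
Qed.

Lemma logistic_law_dominates (theta : Rd R d) :
  logistic_law PX theta `<< logistic_base PX.
Proof.
apply/null_content_dominatesP => A mA A0.
apply: null_set_integral => //.
by apply: measurable_funTS; exact: measurable_logistic_pdf.
Qed.

(** Both sides have the same integral over every measurable set. This makes the integrand of
    [renyi_divergence] explicit. *)
Lemma Radon_Nikodym_logistic (theta : Rd R d) :
  ae_eq (logistic_base PX) setT
    (Radon_Nikodym (charge_of_finite_measure (logistic_law PX theta))
       (logistic_base PX))
    (logistic_pdf theta).
Proof.
have dom : charge_of_finite_measure (logistic_law PX theta) `<< logistic_base PX.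
  exact: logistic_law_dominates.
apply: integral_ae_eq => //.
- exact: Radon_Nikodym_integrable.
- exact: measurable_logistic_pdf.
- by move=> A _ mA; rewrite -Radon_Nikodym_integral.
Qed.

(** The Hellinger integral of order [a], equal to [exp (- (1 - a) D)] for the divergence [D] by
    [renyi_logistic]. *)
Definition affinity (a : R) (theta0 theta : Rd R d) : \bar R :=
  (\int[logistic_base PX]_z (logistic theta z.1 z.2 `^ a *
     logistic theta0 z.1 z.2 `^ (1 - a))%:E)%E.

Let aff_ge0 a theta0 theta (z : bool * Rd R d) :
  (0 <= (logistic theta z.1 z.2 `^ a * logistic theta0 z.1 z.2 `^ (1 - a))%:E)%E.
Proof. by rewrite lee_fin mulr_ge0 ?powR_ge0. Qed.

Let measurable_aff a theta0 (e : measure_display) (T : measurableType e)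
    (theta : T -> Rd R d) (z : T -> bool * Rd R d) :
  measurable_fun [set: T] theta -> measurable_fun [set: T] z ->
  measurable_fun [set: T] (fun t => (logistic (theta t) (z t).1 (z t).2 `^ a *
     logistic theta0 (z t).1 (z t).2 `^ (1 - a))%:E).
Proof.
move=> mt mz; apply/measurable_EFinP; apply: measurable_funM.
  apply: (measurableT_comp (measurable_powR a)).
  exact: measurable_logistic_joint.
apply: (measurableT_comp (measurable_powR (1 - a))).
exact: measurable_logistic_joint.
Qed.

Let measurable_aff1 a theta0 theta : measurable_fun [set: bool * Rd R d]
  (fun z => (logistic theta z.1 z.2 `^ a * logistic theta0 z.1 z.2 `^ (1 - a))%:E).
Proof. exact: (@measurable_aff a theta0 _ _ (cst theta) id). Qed.

Lemma measurable_affinity a theta0 : measurable_fun setT (affinity a theta0).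
Proof.
apply: (measurable_fun_fubini_tonelli_F (m2 := logistic_base PX)
  (fun p : Rd R d * (bool * Rd R d) => (logistic p.1 p.2.1 p.2.2 `^ a *
    logistic theta0 p.2.1 p.2.2 `^ (1 - a))%:E)).
  exact: measurable_aff measurable_fst measurable_snd.
by move=> p; exact: aff_ge0.
Qed.

Lemma affinity_le1 a theta0 theta : 0 < a < 1 -> (affinity a theta0 theta <= 1)%E.
Proof.
move=> a01.
apply: (@le_trans _ _ (\int[logistic_base PX]_z (a * logistic theta z.1 z.2 +
   (1 - a) * logistic theta0 z.1 z.2)%:E)%E).
  apply: ge0_le_integral => //.
  - apply/measurable_EFinP; apply: measurable_funD; apply: measurable_funM => //;
      exact: measurable_logistic1.
  - by move=> z _; rewrite lee_fin powR_young// logistic_gt0.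
have /andP[a0 a1] := a01.
rewrite integral_logistic_base; last 2 first.
- apply/measurable_EFinP; apply: measurable_funD; apply: measurable_funM => //;
    exact: measurable_logistic1.
- move=> z; rewrite lee_fin; have := logistic_ge0 theta z.1 z.2.
  by have := logistic_ge0 theta0 z.1 z.2 => ? ?; nra.
rewrite (eq_integral (cst 1%E)); last first.
  move=> x _ /=; rewrite -EFinD; congr EFin.
  by have := logistic_sum1 theta x; have := logistic_sum1 theta0 x => ? ?; nra.
by rewrite integral_cst// mul1e; exact: probability_le1.
Qed.

(** A function positive everywhere has a positive integral against a probability. This keeps the
    divergence finite and the inverse affinity meaningful. *)
Lemma affinity_gt0 a theta0 theta : (0 < affinity a theta0 theta)%E.
Proof.
rewrite /affinity integral_logistic_base//=.
have mI y : measurable_fun setT (fun x => (logistic theta y x `^ a *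
    logistic theta0 y x `^ (1 - a))%:E : \bar R).
  apply: (@measurable_aff a theta0 _ _ (cst theta) (pair y)) => //; exact: pair1_measurable.
pose f x := ((logistic theta true x `^ a * logistic theta0 true x `^ (1 - a))%:E +
  (logistic theta false x `^ a * logistic theta0 false x `^ (1 - a))%:E)%E.
change (0 < \int[PX]_x f x)%E.
have f0 x : (0 < f x)%E.
  by rewrite /f -EFinD lte_fin addr_gt0 ?mulr_gt0 ?powR_gt0 ?logistic_gt0.
rewrite lt_def integral_ge0 ?andbT; last by move=> x _; exact: ltW.
apply/eqP => I0.
have mf : measurable_fun setT f by exact: emeasurable_funD.
have /(ae_eq_integral_abs PX measurableT mf) [N [mN N0 fN]] :
    (\int[PX]_x `|f x|)%E = 0%E.
  by rewrite -[RHS]I0; apply: eq_integral => x _; rewrite gee0_abs// ltW.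
have : (PX setT <= PX N)%E.
  rewrite le_measure ?inE//; move=> x _; apply: fN => /= /(_ I) fx0.
  by have := f0 x; rewrite fx0 ltxx.
by rewrite N0 probability_setT leNgt lte_fin ltr01.
Qed.

Lemma affinity_fineK a theta0 theta : 0 < a < 1 ->
  affinity a theta0 theta = (fine (affinity a theta0 theta))%:E.
Proof.
move=> a01; rewrite fineK// ge0_fin_numE ?(ltW (affinity_gt0 _ _ _))//.
exact: le_lt_trans (affinity_le1 _ _ a01) (ltry _).
Qed.

Lemma fine_affinity_gt0 a theta0 theta : 0 < a < 1 ->
  0 < fine (affinity a theta0 theta).
Proof.
by move=> a01; have := affinity_gt0 a theta0 theta; rewrite affinity_fineK.
Qed.

Lemma fine_affinity_le1 a theta0 theta : 0 < a < 1 ->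
  fine (affinity a theta0 theta) <= 1.
Proof.
by move=> a01; have := affinity_le1 theta0 theta a01; rewrite affinity_fineK.
Qed.

Lemma renyi_logistic a theta0 theta : 0 < a < 1 ->
  renyi_divergence (logistic_base PX) a
    (logistic_law PX theta) (logistic_law PX theta0) =
  (- ln (fine (affinity a theta0 theta)) / (1 - a))%:E.
Proof.
move=> a01; rewrite /renyi_divergence.
have mRN t : measurable_fun setT
    (Radon_Nikodym (charge_of_finite_measure (logistic_law PX t)) (logistic_base PX)).
  by apply: measurable_int; apply: Radon_Nikodym_integrable;
    exact: logistic_law_dominates.
rewrite (@ae_eq_integral _ _ _ _ setT (fun z => (logistic theta z.1 z.2 `^ a *
    logistic theta0 z.1 z.2 `^ (1 - a))%:E))//.
- rewrite -/(affinity a theta0 theta) affinity_fineK// lne_EFin ?fine_affinity_gt0//.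
  rewrite -EFinM; congr EFin; rewrite mulNr -mulrN mulrC -invrN opprB; congr (_ / _).
- by apply: emeasurable_funM;
    exact: (measurableT_comp (measurable_poweR _) (mRN _)).
- have [N1 [mN1 N10 h1]] := Radon_Nikodym_logistic theta.
  have [N2 [mN2 N20 h2]] := Radon_Nikodym_logistic theta0.
  exists (N1 `|` N2); split; first exact: measurableU.
    exact: null_set_setU.
  move=> z /=; apply: contra_notP => /not_orP[nz1 nz2] _.
  have -> : Radon_Nikodym (charge_of_finite_measure (logistic_law PX theta))
      (logistic_base PX) z = logistic_pdf theta z.
    by apply: contra_notP nz1 => nz; apply: h1 => /(_ I).
  have -> : Radon_Nikodym (charge_of_finite_measure (logistic_law PX theta0))
      (logistic_base PX) z = logistic_pdf theta0 z.
    by apply: contra_notP nz2 => nz; apply: h2 => /(_ I).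
  by [].
Qed.

End model.

(** * The posterior mean of the divergence *)

(** A positive finite mass rules out the fallback branch, so normalizing is a mere rescaling. *)
Lemma integral_mnormalize {d : measure_display} {T : measurableType d}
    {R : realType} (mu : {measure set T -> \bar R}) (P : probability T R)
    (c : R) (f : T -> \bar R) :
  0 < c -> mu setT = c%:E ->
  measurable_fun [set: T] f -> (forall x, (0 <= f x)%E) ->
  (\int[mnormalize mu P]_x f x = c^-1%:E * \int[mu]_x f x)%E.
Proof.
move=> c0 muT mf f0; have c0' : 0 <= c^-1 by rewrite invr_ge0 ltW.
transitivity (\int[mscale (NngNum c0') mu]_x f x)%E.
  apply: eq_measure_integral => A mA _.
  by rewrite /= /mnormalize muT eqe gt_eqF//= /mscale/= muleC.
by rewrite ge0_integral_mscale.
Qed.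

Lemma measurable_funV_gt0 {d : measure_display} {T : measurableType d}
    {R : realType} (f : T -> R) :
  measurable_fun [set: T] f -> (forall x, 0 < f x) ->
  measurable_fun [set: T] (fun x => (f x)^-1).
Proof.
move=> mf f0; rewrite (_ : (fun x => _) = (fun x => f x `^ -1)).
  exact: (measurableT_comp (measurable_powR (-1)) mf).
by apply/funext => x; rewrite powR_inv1// ltW.
Qed.

Section posterior_bound.
Context {R : realType} {d : nat}.
Variables (PX : probability (Rd R d) R) (theta0 : Rd R d).
Variables (p : {i01 R}) (v0 v1 a : R).
Hypothesis a01 : 0 < a < 1.

Let pdf (theta : Rd R d) := spike_slab_pdf p v0 v1 theta.

Let pdf_ge0 theta : 0 <= pdf theta.
Proof. by have := spike_slab_pdf_ge0 p v0 v1 theta; rewrite lee_fin. Qed.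

Let measurable_pdf : measurable_fun [set: Rd R d] pdf.
Proof. by apply/measurable_EFinP; exact: measurable_spike_slab_pdf. Qed.

Lemma integral_spike_slab_pdf :
  (\int[lebesgue_Rd R d]_theta (spike_slab_pdf p v0 v1 theta)%:E = 1)%E.
Proof.
have p0 : 0 <= p%:num by [].
have q0 : 0 <= 1 - p%:num by rewrite subr_ge0.
have mn v : measurable_fun setT (normal_pdf (0 : R) v).
  exact: measurable_normal_pdf.
have n0 v x : 0 <= normal_pdf (0 : R) v x by exact: normal_pdf_ge0.
rewrite (@integral_tuple_prod _ _ _ (@lebesgue_measure R) d (fun _ x =>
    p%:num * normal_pdf 0 (Num.sqrt v1) x +
    (1 - p%:num) * normal_pdf 0 (Num.sqrt v0) x)); last 2 first.
- by move=> _; apply: measurable_funD; apply: measurable_funM => //; exact: mn.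
- by move=> _ x; rewrite addr_ge0// mulr_ge0.
rewrite big1// => _ _.
under eq_integral do rewrite EFinD !EFinM.
rewrite ge0_integralD//; last 4 first.
- by move=> x _; rewrite mule_ge0 ?lee_fin.
- by apply: emeasurable_funM => //; apply/measurable_EFinP; exact: mn.
- by move=> x _; rewrite mule_ge0 ?lee_fin.
- by apply: emeasurable_funM => //; apply/measurable_EFinP; exact: mn.
have I1 (q v : R) : 0 <= q ->
    (\int[lebesgue_measure]_x (q%:E * (normal_pdf 0 v x)%:E) = q%:E)%E.
  move=> q0'; rewrite ge0_integralZl//.
  - by rewrite integral_normal_pdf mule1.
  - by apply/measurable_EFinP; exact: mn.
  - by move=> x _; rewrite lee_fin.
by rewrite !I1// -EFinD subrKC.
Qed.

Section fixed_sample.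
Variables (n : nat) (z : n.-tuple (bool * Rd R d)).

Let r theta := likelihood z theta / likelihood z theta0.

Let r_ge0 theta : 0 <= r theta.
Proof. by rewrite divr_ge0 ?ltW ?likelihood_gt0. Qed.

Let measurable_r : measurable_fun [set: Rd R d] (fun theta => r theta `^ a).
Proof. exact: measurable_likelihood_ratio. Qed.

(** The normalizing constant of the fractional posterior divided by the [a]-th power of
    [likelihood z theta0]. *)
Definition evidence : \bar R :=
  (\int[lebesgue_Rd R d]_theta ((likelihood z theta / likelihood z theta0) `^ a *
     spike_slab_pdf p v0 v1 theta)%:E)%E.

(** Likelihoods are at most 1, so the integrand is at most a sample-dependent constant times the
    prior density, of mass 1. *)
Lemma evidence_lty : (evidence < +oo)%E.
Proof.
apply: (@le_lt_trans _ _ (\int[lebesgue_Rd R d]_theta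
    (((likelihood z theta0)^-1 `^ a)%:E * (pdf theta)%:E))%E).
  apply: ge0_le_integral => //.
  - by move=> theta _; rewrite lee_fin mulr_ge0 ?powR_ge0.
  - by apply/measurable_EFinP; exact: measurable_funM.
  - by apply: emeasurable_funM => //; exact/measurable_EFinP.
  move=> theta _; rewrite -EFinM lee_fin ler_wpM2r//.
  apply: ge0_ler_powR; rewrite ?nnegrE ?r_ge0 ?invr_ge0 ?(ltW (likelihood_gt0 _ _))//.
    by case/andP: a01 => /ltW.
  by rewrite ler_piMl ?likelihood_le1// invr_ge0 ltW// likelihood_gt0.
rewrite ge0_integralZl//; last 3 first.
- exact/measurable_EFinP.
- by move=> theta _; rewrite lee_fin.
- by rewrite lee_fin powR_ge0.
by rewrite integral_spike_slab_pdf mule1 ltry.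
Qed.

Lemma integral_fractional_posterior (f : Rd R d -> \bar R) :
  (0 < evidence)%E -> measurable_fun setT f -> (forall theta, (0 <= f theta)%E) ->
  (\int[fractional_posterior (spike_slab_prior p v0 v1) a z]_theta f theta =
   (fine evidence)^-1%:E * \int[lebesgue_Rd R d]_theta (f theta *
     ((likelihood z theta / likelihood z theta0) `^ a *
      spike_slab_pdf p v0 v1 theta)%:E))%E.
Proof.
move=> ev0 mf f0; set L0 := likelihood z theta0 `^ a.
have L00 : 0 < L0 by rewrite powR_gt0// likelihood_gt0.
have LE theta : likelihood z theta `^ a = L0 * r theta `^ a.
  rewrite /L0 -powRM ?r_ge0 ?(ltW (likelihood_gt0 _ _))//.
  by rewrite mulrC divfK// gt_eqF// likelihood_gt0.
have prior_int (g : Rd R d -> \bar R) : measurable_fun setT g ->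
    (forall theta, (0 <= g theta)%E) ->
    (\int[spike_slab_prior p v0 v1]_theta g theta =
     \int[lebesgue_Rd R d]_theta (g theta * (pdf theta)%:E))%E.
  move=> mg g0.
  exact: (@ge0_integral_density _ _ _ (lebesgue_Rd R d) _
    (measurable_spike_slab_pdf p v0 v1) (spike_slab_pdf_ge0 p v0 v1) g mg g0
    (fun=> erefl)).
pose nu := density_measure (spike_slab_prior p v0 v1)
  (measurable_tempered_likelihood z a) (tempered_likelihood_ge0 z a).
have nu_int (g : Rd R d -> \bar R) : measurable_fun setT g ->
    (forall theta, (0 <= g theta)%E) ->
    (\int[nu]_theta g theta =
     L0%:E * \int[lebesgue_Rd R d]_theta (g theta * (r theta `^ a * pdf theta)%:E))%E.
  move=> mg g0; rewrite (@ge0_integral_density _ _ _ (spike_slab_prior p v0 v1) _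
    (measurable_tempered_likelihood z a) (tempered_likelihood_ge0 z a) g mg g0
    (fun=> erefl)).
  have mL := measurable_tempered_likelihood z a.
  rewrite prior_int; last 2 first.
  - exact: emeasurable_funM.
  - move=> theta; exact: (mule_ge0 (g0 theta) (tempered_likelihood_ge0 z a theta)).
  have rp0 theta : (0 <= (r theta `^ a * pdf theta)%:E)%E.
    by rewrite lee_fin mulr_ge0 ?powR_ge0.
  have mrp : measurable_fun setT (fun theta => (r theta `^ a * pdf theta)%:E).
    by apply/measurable_EFinP; exact: measurable_funM.
  rewrite -ge0_integralZl//; last 3 first.
  - exact: emeasurable_funM.
  - move=> theta _; exact: (mule_ge0 (g0 theta) (rp0 theta)).
  - by rewrite lee_fin ltW.
  apply: eq_integral => theta _; rewrite LE -muleA -EFinM muleCA -EFinM.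
  by congr (_ * _%:E)%E; rewrite mulrA.
have nuT : nu setT = (L0%:E * evidence)%E.
  have := nu_int (cst 1%E) (measurable_cst _) (fun=> lee01).
  rewrite integral_cst// mul1e => nuT; apply: (etrans nuT); congr (_ * _)%E.
  by apply: eq_integral => theta _; rewrite mul1e.
have evE : evidence = (fine evidence)%:E.
  by rewrite fineK// ge0_fin_numE ?evidence_lty// ltW.
have e0 : 0 < fine evidence by rewrite -lte_fin -evE.
have nuTE : nu setT = (L0 * fine evidence)%:E by rewrite nuT [in LHS]evE.
have LV0 : 0 < L0 * fine evidence by rewrite mulr_gt0.
rewrite [LHS](integral_mnormalize _ LV0 nuTE mf f0) nu_int// muleA -EFinM.
by congr (_%:E * _)%E; field; rewrite !gt_eqF.
Qed.

Let aff theta := fine (affinity PX a theta0 theta).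

Let aff_gt0 theta : 0 < aff theta.
Proof. exact: fine_affinity_gt0. Qed.

Let aff_le1 theta : aff theta <= 1.
Proof. exact: fine_affinity_le1. Qed.

Let measurable_aff : measurable_fun [set: Rd R d] aff.
Proof.
exact: (measurableT_comp (@fine_measurable R setT measurableT)
  (measurable_affinity _ _ _)).
Qed.

Definition exp_moment : \bar R :=
  (\int[lebesgue_Rd R d]_theta ((likelihood z theta / likelihood z theta0) `^ a *
     (fine (affinity PX a theta0 theta))^-1 ^+ n * spike_slab_pdf p v0 v1 theta)%:E)%E.

Let measurable_inv_aff : measurable_fun [set: Rd R d] (fun theta => (aff theta)^-1 ^+ n).
Proof.
by apply: measurable_funX; exact: measurable_funV_gt0.
Qed.

Lemma measurable_renyi_logistic : measurable_fun setT (fun theta =>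
  renyi_divergence (logistic_base PX) a
    (logistic_law PX theta) (logistic_law PX theta0)).
Proof.
under eq_fun do rewrite renyi_logistic//.
apply/measurable_EFinP; apply: measurable_funM => //.
apply: measurableT_comp => //.
exact: (measurableT_comp (@measurable_ln R) measurable_aff).
Qed.

Lemma renyi_logistic_ge0 theta : (0 <= renyi_divergence (logistic_base PX) a
    (logistic_law PX theta) (logistic_law PX theta0))%E.
Proof.
rewrite renyi_logistic// lee_fin divr_ge0 ?subr_ge0//; last first.
  by case/andP: a01 => _ /ltW.
by rewrite oppr_ge0 ln_le0// aff_le1.
Qed.

(* Jensen's inequality for exp, in the form of the tangent line of ln at B. *)
Lemma posterior_renyi_le (B : R) : (0 < n)%N -> expR 1 <= B ->
  (0 < evidence)%E -> (exp_moment <= B%:E * evidence)%E ->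
  (\int[fractional_posterior (spike_slab_prior p v0 v1) a z]_theta
     renyi_divergence (logistic_base PX) a
       (logistic_law PX theta) (logistic_law PX theta0) <=
   (ln B / (n%:R * (1 - a)))%:E)%E.
Proof.
move=> n0 eB ev0 UB; have /andP[a0 a1] := a01.
have B0 : 0 < B by apply: lt_le_trans eB; exact: expR_gt0.
have lnB1 : 1 <= ln B by rewrite -[leLHS]expRK ler_ln ?posrE ?expR_gt0.
have na0 : 0 < n%:R * (1 - a) by rewrite mulr_gt0 ?ltr0n ?subr_gt0.
have evE : evidence = (fine evidence)%:E.
  by rewrite fineK// ge0_fin_numE ?evidence_lty// ltW.
have e0 : 0 < fine evidence by rewrite -lte_fin -evE.
rewrite integral_fractional_posterior//; last 2 first.
- exact: measurable_renyi_logistic.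
- exact: renyi_logistic_ge0.
rewrite lee_pdivrMl//.
set k := (n%:R * (1 - a))^-1; have k0 : 0 <= k by rewrite invr_ge0 ltW.
have mV : measurable_fun [set: Rd R d] (fun theta => (r theta `^ a * pdf theta)%:E).
  by apply/measurable_EFinP; exact: measurable_funM.
have mU : measurable_fun [set: Rd R d] (fun theta =>
    (r theta `^ a * (aff theta)^-1 ^+ n * pdf theta)%:E).
  by apply/measurable_EFinP; apply: measurable_funM => //; exact: measurable_funM.
have U0 theta : 0 <= r theta `^ a * (aff theta)^-1 ^+ n * pdf theta.
  by rewrite !mulr_ge0 ?powR_ge0// exprn_ge0// invr_ge0 ltW.
have V0 theta : 0 <= r theta `^ a * pdf theta by rewrite mulr_ge0 ?powR_ge0.
have kB0 : 0 <= k * (ln B - 1) by rewrite mulr_ge0// subr_ge0.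
have kB1 : 0 <= k / B by rewrite mulr_ge0// invr_ge0 ltW.
(* Tangent line [ln y <= ln B - 1 + y / B] at [y = (aff theta)^-1 ^+ n]. As [expR 1 <= B], its
   constant term is nonnegative and the two integrals can be split; the hypothesis on [exp_moment]
   then gives back the missing 1. *)
apply: (@le_trans _ _ (\int[lebesgue_Rd R d]_theta
   ((k * (ln B - 1))%:E * (r theta `^ a * pdf theta)%:E +
    (k / B)%:E * (r theta `^ a * (aff theta)^-1 ^+ n * pdf theta)%:E))%E).
  apply: ge0_le_integral => //.
  - move=> theta _; apply: (mule_ge0 (renyi_logistic_ge0 theta)).
    by rewrite lee_fin; exact: V0.
  - by apply: emeasurable_funM => //; exact: measurable_renyi_logistic.
  - by apply: emeasurable_funD; exact: emeasurable_funM.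
  move=> theta _; rewrite renyi_logistic// -!EFinM -EFinD lee_fin -/(aff theta).
  rewrite [leRHS](_ : _ = (k * (ln B - 1 + (aff theta)^-1 ^+ n / B)) *
    (r theta `^ a * pdf theta)); last by ring.
  apply: (ler_wpM2r (V0 theta)).
  have -> : - ln (aff theta) / (1 - a) = k * ln ((aff theta)^-1 ^+ n).
    rewrite lnXn ?invr_gt0// lnV ?posrE// -mulr_natr /k.
    by field; rewrite !gt_eqF ?subr_gt0 ?ltr0n.
  rewrite ler_wpM2l//.
  have y0 : 0 < (aff theta)^-1 ^+ n by rewrite exprn_gt0// invr_gt0.
  have := expR_ge1Dx (ln ((aff theta)^-1 ^+ n) - ln B).
  by rewrite expRD expRN !lnK ?posrE//; lra.
rewrite ge0_integralD//; last 4 first.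
- by move=> theta _; rewrite mule_ge0 ?lee_fin.
- exact: emeasurable_funM.
- by move=> theta _; rewrite mule_ge0 ?lee_fin.
- exact: emeasurable_funM.
rewrite !ge0_integralZl//; try by move=> theta _; rewrite lee_fin.
rewrite -/evidence -/exp_moment.
apply: (@le_trans _ _ ((k * (ln B - 1))%:E * evidence + (k / B)%:E * (B%:E * evidence))%E).
  by rewrite leeD2l// lee_wpmul2l// lee_fin.
rewrite evE -!EFinM -EFinD lee_fin le_eqVlt; apply/orP; left; apply/eqP.
by rewrite -/k; field; rewrite gt_eqF.
Qed.

End fixed_sample.

(** * Mean and measurability over the random sample *)

Section random_sample.
Variable n : nat.

Let P := tuple_product_measure (logistic_law PX theta0) n.

Let measurable_joint : measurable_fun [set: n.-tuple (bool * Rd R d) * Rd R d]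
  (fun q => (likelihood q.1 q.2 / likelihood q.1 theta0) `^ a).
Proof.
apply: (measurableT_comp (measurable_powR a)); apply: measurable_funM.
  apply: measurable_prod => i _; apply: measurable_logistic_joint => //.
  by apply: (measurableT_comp (measurable_tnth i)).
apply: measurable_funV_gt0 => [|q]; last exact: likelihood_gt0.
apply: measurable_prod => i _; apply: measurable_logistic_joint => //.
by apply: (measurableT_comp (measurable_tnth i)).
Qed.

Let measurable_evidence_joint :
  measurable_fun [set: n.-tuple (bool * Rd R d) * Rd R d]
  (fun q => ((likelihood q.1 q.2 / likelihood q.1 theta0) `^ a * pdf q.2)%:E).
Proof.
apply/measurable_EFinP; apply: measurable_funM => //.
exact: (measurableT_comp measurable_pdf).
Qed.

Let measurable_moment_joint :
  measurable_fun [set: n.-tuple (bool * Rd R d) * Rd R d]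
  (fun q => ((likelihood q.1 q.2 / likelihood q.1 theta0) `^ a *
     (fine (affinity PX a theta0 q.2))^-1 ^+ n * pdf q.2)%:E).
Proof.
apply/measurable_EFinP; apply: measurable_funM; last first.
  exact: (measurableT_comp measurable_pdf).
apply: measurable_funM => //; apply: measurable_funX.
apply: measurable_funV_gt0 => [|q]; last exact: fine_affinity_gt0.
apply: (measurableT_comp (@fine_measurable R setT measurableT)).
exact: (measurableT_comp (measurable_affinity PX a theta0)).
Qed.

Let moment_ge0 (q : n.-tuple (bool * Rd R d) * Rd R d) :
  (0 <= ((likelihood q.1 q.2 / likelihood q.1 theta0) `^ a *
     (fine (affinity PX a theta0 q.2))^-1 ^+ n * pdf q.2)%:E)%E.
Proof.
by rewrite lee_fin !mulr_ge0 ?powR_ge0// exprn_ge0// invr_ge0 ltW// fine_affinity_gt0.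
Qed.

Lemma measurable_evidence : measurable_fun setT (@evidence n).
Proof.
apply: (measurable_fun_fubini_tonelli_F (m2 := lebesgue_Rd R d) _ measurable_evidence_joint).
by move=> q; rewrite lee_fin mulr_ge0 ?powR_ge0.
Qed.

Lemma measurable_exp_moment : measurable_fun setT (@exp_moment n).
Proof.
exact: (measurable_fun_fubini_tonelli_F (m2 := lebesgue_Rd R d) _
  measurable_moment_joint moment_ge0).
Qed.

(** After Tonelli, for fixed [theta] independence makes the mean of the tempered likelihood ratio
    the [n]-th power of the affinity. This cancels the inverse power and leaves the prior mass. *)
Lemma integral_exp_moment : (\int[P]_z exp_moment z = 1)%E.
Proof.
rewrite (fubini_tonelli _ measurable_moment_joint moment_ge0)/=.
rewrite -integral_spike_slab_pdf; apply: eq_integral => theta _.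
have A0 := fine_affinity_gt0 PX theta0 theta a01.
set A := fine _ in A0 *.
have mr : measurable_fun setT (fun w : bool * Rd R d =>
    (logistic theta w.1 w.2 / logistic theta0 w.1 w.2) `^ a).
  apply: (measurableT_comp (measurable_powR a)); apply: measurable_funM.
    exact: measurable_logistic1.
  apply: measurable_funV_gt0 => [|w]; last exact: logistic_gt0.
  exact: measurable_logistic1.
have ratioE (z : n.-tuple (bool * Rd R d)) :
    (likelihood z theta / likelihood z theta0) `^ a =
    \prod_(i < n) ((logistic theta (tnth z i).1 (tnth z i).2 /
                    logistic theta0 (tnth z i).1 (tnth z i).2) `^ a).
  rewrite /likelihood -prodf_div powR_prod// => i.
  by rewrite divr_ge0 ?logistic_ge0.
have I1 : (\int[P]_z ((likelihood z theta / likelihood z theta0) `^ a)%:E =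
    (A ^+ n)%:E)%E.
  under eq_integral do rewrite ratioE.
  rewrite (@integral_tuple_prod _ _ _ (logistic_law PX theta0) n (fun _ w =>
    (logistic theta w.1 w.2 / logistic theta0 w.1 w.2) `^ a))//; last first.
    by move=> _ w; exact: powR_ge0.
  rewrite (eq_bigr (fun=> A%:E)).
    by rewrite prodEFin prodr_const card_ord.
  move=> _ _; rewrite integral_logistic_law; last 2 first.
  - exact/measurable_EFinP.
  - by move=> w; rewrite lee_fin powR_ge0.
  rewrite /A -affinity_fineK//; apply: eq_integral => w _.
  have l0 := logistic_gt0 theta0 w.1 w.2.
  rewrite /logistic_pdf -EFinM; congr EFin.
  rewrite powRM ?logistic_ge0 ?invr_ge0 ?logistic_ge0// -mulrA; congr (_ * _).
  move: (logistic _ _ _) l0 => l l0.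
  rewrite /powR !gt_eqF ?invr_gt0// lnV ?posrE// -[X in _ * X]lnK ?posrE//.
  by rewrite -expRD; congr expR; ring.
under eq_integral do rewrite -mulrA EFinM.
rewrite ge0_integralZr//; last 3 first.
- under eq_fun do rewrite ratioE.
  exact: (@measurable_prod_tuple _ _ R n (fun _ w => (logistic theta w.1 w.2 /
    logistic theta0 w.1 w.2) `^ a) (fun=> mr)).
- by move=> z _; rewrite lee_fin powR_ge0.
- by rewrite lee_fin mulr_ge0// exprn_ge0// invr_ge0 ltW.
rewrite I1 -EFinM; congr EFin.
by rewrite mulrA -exprMn divff ?gt_eqF// expr1n mul1r.
Qed.

(** The posterior mean is a quotient of two parametric integrals, each measurable by Tonelli, with a
    positive denominator. *)
Lemma measurable_posterior_renyi :
  (forall z : n.-tuple (bool * Rd R d), (0 < evidence z)%E) ->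
  measurable_fun setT (fun z : n.-tuple (bool * Rd R d) =>
    (\int[fractional_posterior (spike_slab_prior p v0 v1) a z]_theta
     renyi_divergence (logistic_base PX) a
       (logistic_law PX theta) (logistic_law PX theta0))%E).
Proof.
move=> ev0.
have D0 := renyi_logistic_ge0.
have mD := measurable_renyi_logistic.
under eq_fun do rewrite integral_fractional_posterior//.
apply: emeasurable_funM.
  apply/measurable_EFinP; apply: measurable_funV_gt0 => [|z]; last first.
    by rewrite fine_gt0// ev0 evidence_lty.
  exact: (measurableT_comp (@fine_measurable R setT measurableT) measurable_evidence).
pose f (q : n.-tuple (bool * Rd R d) * Rd R d) :=
  (renyi_divergence (logistic_base PX) a (logistic_law PX q.2) (logistic_law PX theta0) *
    ((likelihood q.1 q.2 / likelihood q.1 theta0) `^ a * pdf q.2)%:E)%E.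
apply: (measurable_fun_fubini_tonelli_F (m2 := lebesgue_Rd R d) f).
  apply: emeasurable_funM => //.
  exact: (measurableT_comp mD).
by move=> q; rewrite /f mule_ge0// lee_fin mulr_ge0 ?powR_ge0.
Qed.

End random_sample.
End posterior_bound.

(** * Moments of the covariates *)

(** [ln (1 - 1 / 2) <= - (1 / 2)] gives the case of 2. *)
Lemma ln_natr_ge {R : realType} (m : nat) : (2 <= m)%N -> 1 / 2 <= ln m%:R :> R.
Proof.
move=> m2; have m2' : 2 <= m%:R :> R by rewrite ler_nat.
have := @le_ln1Dx R (- (1 / 2)); rewrite (_ : 1 + _ = 2^-1); last by lra.
rewrite lnV ?posrE// => /(_ ltac:(lra)) h.
have : ln 2 <= ln m%:R :> R by rewrite ler_ln ?posrE//; lra.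
lra.
Qed.

Lemma measurable_norm2 {R : realType} {d : nat} :
  measurable_fun [set: Rd R d] (@norm2 R d).
Proof.
apply: (measurableT_comp (continuous_measurable_fun (@sqrt_continuous R))).
apply: measurable_sum => i; apply: measurable_funX.
exact: measurable_tnth.
Qed.

Lemma norm2_ge0 {R : realType} {d : nat} (x : Rd R d) : 0 <= norm2 x.
Proof. exact: sqrtr_ge0. Qed.

Section covariate_moments.
Context {R : realType} {d : nat}.
Variable PX : probability (Rd R d) R.
Hypothesis EX2 : ('E_PX[(fun x => norm2 x ^+ 2)%R] < +oo)%E.

Let measurable_EFin_norm2 : measurable_fun [set: Rd R d] (fun x => (norm2 x)%:E).
Proof. by apply/measurable_EFinP; exact: measurable_norm2. Qed.

Let integral1 : (\int[PX]_x 1 = 1)%E.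
Proof. by rewrite integral_cst// mul1e; exact: probability_setT. Qed.

(** [norm2 x <= 1 + norm2 x ^+ 2], so the second moment controls the first. *)
Lemma expectation_norm2_fin :
  ('E_PX[@norm2 R d] = (fine 'E_PX[@norm2 R d])%:E)%E.
Proof.
have E0 : (0 <= 'E_PX[@norm2 R d])%E.
  by rewrite unlock integral_ge0// => x _; rewrite lee_fin norm2_ge0.
rewrite fineK// ge0_fin_numE//; move: EX2; rewrite !unlock => EX2'.
have mX2 : measurable_fun setT (fun x : Rd R d => (norm2 x ^+ 2)%:E).
  by apply/measurable_EFinP; apply: measurable_funX; exact: measurable_norm2.
apply: (@le_lt_trans _ _ (\int[PX]_x (1 + (norm2 x ^+ 2)%:E))%E).
  apply: ge0_le_integral => //.
  - by move=> x _; rewrite lee_fin norm2_ge0.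
  - exact: emeasurable_funD.
  move=> x _; rewrite -EFinD lee_fin; have := norm2_ge0 x.
  have := sqr_ge0 (norm2 x - 1); nra.
rewrite ge0_integralD//; last by move=> x _; rewrite lee_fin sqr_ge0.
by rewrite integral1 lte_add_pinfty// ltry.
Qed.

(** By independence the mean is [(1 + m / n) ^+ n], at most [expR m] uniformly in [n]. *)
Lemma integral_prod_norm2_le (n : nat) (theta0 : Rd R d) : (0 < n)%N ->
  (\int[tuple_product_measure (logistic_law PX theta0) n]_z
     (\prod_(i < n) (1 + norm2 (tnth z i).2 / n%:R))%:E <=
   (expR (fine 'E_PX[@norm2 R d]))%:E)%E.
Proof.
move=> n0; have n0' : 0 < n%:R :> R by rewrite ltr0n.
set m := fine _.
have m0 : 0 <= m.
  rewrite /m fine_ge0// unlock integral_ge0// => x _.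
  by rewrite lee_fin norm2_ge0.
have mg : measurable_fun setT (fun x : Rd R d => 1 + norm2 x / n%:R).
  apply: measurable_funD => //; apply: measurable_funM => //.
  exact: measurable_norm2.
have g0 (x : Rd R d) : 0 <= 1 + norm2 x / n%:R.
  by rewrite addr_ge0// divr_ge0 ?norm2_ge0.
rewrite (@integral_tuple_prod _ _ _ (logistic_law PX theta0) n
  (fun _ w => 1 + norm2 w.2 / n%:R)); last 2 first.
- by move=> _; exact: (measurableT_comp mg measurable_snd).
- by move=> _ w; exact: g0.
rewrite (eq_bigr (fun=> (1 + m / n%:R)%:E)).
  rewrite prodEFin prodr_const card_ord lee_fin.
  apply: (@le_trans _ _ (expR (m / n%:R) ^+ n)).
    by rewrite lerXn2r ?nnegrE ?expR_ge0 ?addr_ge0 ?divr_ge0// expR_ge1Dx.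
  by rewrite -expRM_natr divfK// gt_eqF.
move=> _ _; rewrite (integral_logistic_law_covariate PX theta0 mg g0).
under eq_integral do rewrite EFinD EFinM.
rewrite ge0_integralD//; last 2 first.
- by move=> x _; rewrite mule_ge0// lee_fin ?norm2_ge0// invr_ge0 ltW.
- exact: emeasurable_funM.
rewrite integral1 ge0_integralZr//; last by move=> x _; rewrite lee_fin norm2_ge0.
rewrite (_ : integral _ _ _ = m%:E) ?EFinD//.
by rewrite /m -expectation_norm2_fin unlock.
Qed.

End covariate_moments.

(** * Constants and the final union bound *)

Lemma ln_bound {R : realType} (N iv1 C3 L : R) (s : nat) : 2 <= N -> 0 <= iv1 -> 0 <= C3 ->
  1 / 2 <= L -> s%:R * L <= N ->
  ln (N * (expR (1 + iv1) * (expR (L + C3)) ^+ s * (N * expR (N / 2)) ^+ 2)) <=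
  (6 + iv1 + 2 * C3) * N.
Proof.
move=> N2 iv10 C30 L0 sL; have N0 : 0 < N by lra.
have e0 (x : R) : 0 < expR x by exact: expR_gt0.
rewrite lnM ?posrE ?mulr_gt0 ?exprn_gt0 ?mulr_gt0//.
rewrite lnM ?posrE ?mulr_gt0 ?exprn_gt0 ?mulr_gt0//.
rewrite lnM ?posrE ?exprn_gt0// !lnXn ?mulr_gt0// lnM ?posrE// !expRK.
have lnN := ltW (ln_sublinear N0).
rewrite -[(L + C3) *+ s]mulr_natr -[(ln N + N / 2) *+ 2]mulr_natr.
have s0 : 0 <= s%:R :> R by [].
have sN : s%:R <= 2 * N.
  by have := ler_wpM2l s0 L0; lra.
have := ler_wpM2r C30 sN; have := ler_wpM2l iv10 N2.
lra.
Qed.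

Lemma norm0_gt0 {R : realType} {d : nat} (theta : Rd R d) :
  norm2 theta = 1 -> (0 < norm0 theta)%N.
Proof.
move=> h; rewrite /norm0 card_gt0; apply/set0Pn.
apply: contrapT => nj; have : norm2 theta = 0.
  rewrite /norm2 big1 ?sqrtr0// => j _; apply/eqP; rewrite sqrf_eq0.
  by apply: contrapT => /negP tj; apply: nj; exists j; rewrite inE.
by move/eqP; rewrite h oner_eq0.
Qed.

(** A unit vector with a zero coordinate lives in dimension [d >= 2], where [2 * d * ln d >= 1]. *)
Lemma spike_variance_le {R : realType} (n d : nat) (theta0 : Rd R d) (v0 : R) :
  (0 < n)%N -> 0 < v0 -> norm2 theta0 = 1 ->
  ((1 < d)%N -> v0 <= 1 / (2 * n%:R ^+ 2 * d%:R * ln d%:R)) ->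
  [exists j, (tnth theta0 j : R) == 0] -> n%:R ^+ 2 * v0 <= 1.
Proof.
move=> n0 v00 /norm0_gt0 s0 v0_le /existsP[j /eqP tj].
have d2 : (1 < d)%N.
  rewrite ltnNge; apply/negP => d1; move: s0; rewrite card_gt0 => /set0Pn[i].
  rewrite inE => /negP; apply; rewrite -tj; apply/eqP; congr (tnth _ _).
  apply: val_inj => /=; move: (ltn_ord i) (ltn_ord j) d1; clear.
  by case: d i j => [|[|d]]//= [i +] [j +] /=; case: i => //; case: j.
have d2' : 2 <= d%:R :> R by rewrite ler_nat.
have lnd := @ln_natr_ge R d d2.
have n2 : 0 < n%:R ^+ 2 :> R by rewrite exprn_gt0// ltr0n.
have dl : 1 <= 2 * d%:R * ln d%:R :> R by nra.
have D0 : 0 < 2 * n%:R ^+ 2 * d%:R * ln d%:R :> R.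
  have -> : 2 * n%:R ^+ 2 * d%:R * ln d%:R = n%:R ^+ 2 * (2 * d%:R * ln d%:R) :> R.
    by ring.
  by rewrite mulr_gt0//; lra.
have := v0_le d2; rewrite ler_pdivlMr// => h; apply: le_trans h.
rewrite (_ : v0 * _ = (n%:R ^+ 2 * v0) * (2 * d%:R * ln d%:R)); last by ring.
by rewrite ler_peMr// mulr_ge0// ltW.
Qed.

Unset Implicit Arguments.
Set Strict Implicit.

Theorem theorem5p1 (R : realType) (v1 : R) (v1_gt0 : 0 < v1) :
  exists2 c : R, 0 < c &
  forall (n d : nat) (PX : probability (Rd R d) R) (theta0 : Rd R d)
    (EX2 : ('E_PX[(fun x => norm2 x ^+ 2)%R] < +oo)%E)
    (norm2_theta0 : norm2 theta0 = 1)
    (norm0_theta0 : (norm0 theta0 < n)%N)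
    (p : {i01 R}) (v0 : R)
    (v0_gt0 : 0 < v0) (v0_ll_v1 : v0 < v1)
    (pE : p%:num = 1 - expR (- (1 / d%:R)))
    (v0_le : (1 < d)%N -> v0 <= 1 / (2 * n%:R ^+ 2 * d%:R * ln d%:R)),
  let K1 : R := 2 * fine 'E_PX[@norm2 R d] in
  let eps : R :=
    Num.max K1 ((norm0 theta0)%:R * ln (n%:R * d%:R)) / n%:R in
  forall (a : R) (a_gt0 : 0 < a) (a_lt1 : a < 1),
  let P := tuple_product_measure (logistic_law PX theta0) n in
  (P [set z : n.-tuple (bool * Rd R d) |
      \int[fractional_posterior (spike_slab_prior p v0 v1) a z]_theta
         renyi_divergence (logistic_base PX) a
           (logistic_law PX theta) (logistic_law PX theta0)
      <= (c * (2 * (a + 1) / (1 - a)) * eps)%:E]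
   >= (1 - 2 / (n%:R * eps))%:E)%E.
Proof.
(* [k <= 1] keeps the deviation [k / n] below [1 / n], and [2 * k ^+ 2 <= v1] lets the slab dominate
   that Gaussian. *)
pose k : R := Num.min 1 (Num.sqrt v1 / 2).
have sv1 : 0 < Num.sqrt v1 by rewrite sqrtr_gt0.
have k0 : 0 < k by rewrite lt_min ltr01 divr_gt0.
have k1 : k <= 1 by rewrite ge_min lexx.
have ksv : k <= Num.sqrt v1 / 2 by rewrite ge_min lexx orbT.
have kv1 : 2 * k ^+ 2 <= v1 by rewrite -[leRHS]sqr_sqrtr ?ltW//; nra.
pose C3 : R := ln (2 * Num.sqrt v1 / k).
have C30 : 0 <= C3 by rewrite ln_ge0// ler_pdivlMr//; lra.
have iv10 : 0 <= v1^-1 by rewrite invr_ge0 ltW.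
exists (6 + v1^-1 + 2 * C3); first by lra.
move=> n d PX theta0 EX2 nt0 s_n p v0 v00 v0v1 pE v0_le K1 eps a a0 a1.
set P := tuple_product_measure _ n; cbv zeta.
have s0 := norm0_gt0 nt0.
(* A unit vector has at least one nonzero entry, so [norm0 theta0 < n] forces [n >= 2], which bounds
   [ln (n * d)] away from 0. *)
have n2 : (1 < n)%N by exact: leq_ltn_trans s0 s_n.
have n0 : (0 < n)%N by exact: ltnW.
have d0 : (0 < d)%N.
  by move: s0; rewrite card_gt0 => /set0Pn[j _]; exact: leq_ltn_trans (leq0n _) (ltn_ord j).
have a01 : 0 < a < 1 by rewrite a0.
have nR0 : 0 < n%:R :> R by rewrite ltr0n.
have dR0 : 0 < d%:R :> R by rewrite ltr0n.
set N : R := Num.max K1 ((norm0 theta0)%:R * ln (n%:R * d%:R)) in eps *.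
have neps : n%:R * eps = N by rewrite /eps mulrC divfK ?gt_eqF.
have lnd : 1 / 2 <= ln (n%:R * d%:R) :> R.
  by rewrite -natrM; apply: ln_natr_ge; rewrite (leq_trans n2)// leq_pmulr.
have sL : (norm0 theta0)%:R * ln (n%:R * d%:R) <= N by rewrite le_max lexx orbT.
have N0 : 0 < N.
  by apply: lt_le_trans sL; rewrite mulr_gt0 ?ltr0n//; lra.
rewrite neps.
(* For [N <= 2] the claimed probability [1 - 2 / N] is not positive. *)
have [N_le2|/ltW N2] := leP N 2.
  apply: le_trans (measure_ge0 _ _); rewrite lee_fin subr_le0.
  by rewrite ler_pdivlMr// mul1r.
pose m : R := fine ('E_PX[@norm2 R d])%E.
have mN : m <= N / 2.
  have K1N : K1 <= N by rewrite le_max lexx.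
  have K1m : K1 = 2 * m by [].
  lra.
pose W (z : n.-tuple (bool * Rd R d)) : R :=
  \prod_(i < n) (1 + norm2 (tnth z i).2 / n%:R).
have W1 z : 0 < W z.
  by apply: prodr_gt0 => i _; rewrite ltr_pwDl// divr_ge0 ?norm2_ge0.
have mW : measurable_fun setT (fun z => (W z)%:E).
  apply: (@measurable_prod_tuple _ _ R n (fun _ w => 1 + norm2 w.2 / n%:R)) => _.
  apply: measurable_funD => //; apply: measurable_funM => //.
  exact: (measurableT_comp measurable_norm2 measurable_snd).
pose rho : R := k / (2 * (n%:R * d%:R) * Num.sqrt v1).
have rho0 : 0 < rho by rewrite divr_gt0 ?mulr_gt0.
have rhoV : rho^-1 = expR (ln (n%:R * d%:R) + C3).
  rewrite expRD !lnK ?posrE ?mulr_gt0 ?invr_gt0// /rho.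
  by field; rewrite !gt_eqF.
have evW z : ((expR (- (1 + v1^-1)) * rho ^+ norm0 theta0 / W z ^+ 2)%:E <=
    evidence theta0 p v0 v1 a z)%E.
  have := @evidence_ge R n d z theta0 p v0 v1 k a n0 d0 v1_gt0 k0 kv1 pE k1 v00
    (spike_variance_le n0 v00 nt0 v0_le) a01.
  by rewrite nt0 expr1n mul1r.
have ev0 (z : n.-tuple (bool * Rd R d)) : (0 < evidence theta0 p v0 v1 a z)%E.
  apply: (lt_le_trans _ (evW z)); rewrite lte_fin divr_gt0 ?exprn_gt0//.
  by rewrite mulr_gt0 ?expR_gt0 ?exprn_gt0.
(* Markov level for [W]: its mean is at most [expR m <= expR (N / 2)], so it reaches [C] with
   probability at most [1 / N]. *)
pose C : R := N * expR (N / 2).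
have C0 : 0 < C by rewrite mulr_gt0 ?expR_gt0.
(* [N] times the inverse of the lower bound [evW] with [W z] replaced by [C]. *)
pose B : R := N * (expR (1 + v1^-1) *
  (expR (ln (n%:R * d%:R) + C3)) ^+ norm0 theta0 * C ^+ 2).
have eB : expR 1 <= B.
  rewrite /B /C; apply: (@le_trans _ _ (1 * (expR (1 + v1^-1) * 1 * 1))).
    by rewrite mul1r !mulr1 ler_expR lerDl.
  have N1 : 1 <= N by lra.
  have eN : 1 <= expR (N / 2) by rewrite -[leLHS]expR0 ler_expR; lra.
  have e3 : 1 <= expR (ln (n%:R * d%:R) + C3) ^+ norm0 theta0.
    by rewrite exprn_ege1// -[leLHS]expR0 ler_expR; lra.
  have C1 : 1 <= (N * expR (N / 2)) ^+ 2 by rewrite exprn_ege1//; nra.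
  rewrite ler_pM// ?mulr_ge0 ?expR_ge0// ler_pM// ?mulr_ge0 ?expR_ge0//.
  by rewrite ler_pM// expR_ge0.
have lnB : ln B <= (6 + v1^-1 + 2 * C3) * N by exact: ln_bound.
set S := [set z | _].
have mS : measurable S.
  have := @measurable_posterior_renyi R d PX theta0 p v0 v1 a a01 n ev0.
  move=> mF; rewrite -[S]setTI; apply: measurable_lee => //; exact: measurable_cst.
pose E1 := [set z : n.-tuple (bool * Rd R d) |
  (N%:E <= exp_moment PX theta0 p v0 v1 a z)%E].
pose E2 := [set z : n.-tuple (bool * Rd R d) | (C%:E <= (W z)%:E)%E].
have mU := @measurable_exp_moment R d PX theta0 p v0 v1 a a01 n.
have mE1 : measurable E1.
  by rewrite -[E1]setTI; apply: measurable_lee => //; exact: measurable_cst.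
have mE2 : measurable E2.
  by rewrite -[E2]setTI; apply: measurable_lee => //; exact: measurable_cst.
have cover : setT `<=` S `|` (E1 `|` E2).
  move=> z _; have [?|UN] := leP N%:E (exp_moment PX theta0 p v0 v1 a z).
    by right; left.
  have [?|WC] := leP C%:E (W z)%:E; first by right; right.
  rewrite lte_fin in WC; left; rewrite /S/=.
  have UB : (exp_moment PX theta0 p v0 v1 a z <= B%:E * evidence theta0 p v0 v1 a z)%E.
    apply: (le_trans (ltW UN)).
    apply: (@le_trans _ _ (B%:E *
        (expR (- (1 + v1^-1)) * rho ^+ norm0 theta0 / W z ^+ 2)%:E)%E).
      rewrite -EFinM lee_fin /B -rhoV exprVn.
      rewrite [leRHS](_ : _ = N * (C ^+ 2 / W z ^+ 2)); last first.
        by rewrite expRN; field; rewrite !gt_eqF ?exprn_gt0 ?expR_gt0.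
      apply: ler_peMr; first exact: ltW.
      by rewrite -exprVn -exprMn exprn_ege1// ler_pdivlMr// mul1r ltW.
    by apply: lee_wpmul2l => //; rewrite lee_fin (le_trans _ eB)// expR_ge0.
  apply: (le_trans (posterior_renyi_le a01 n0 eB (ev0 z) UB)).
  rewrite lee_fin ler_pdivrMr; last by rewrite mulr_gt0// subr_gt0.
  apply: (le_trans lnB); rewrite -neps.
  (* Clearing the denominator leaves the bound on [ln B] times [2 * (a + 1)], which exceeds 1. *)
  rewrite (_ : _ * (n%:R * (1 - a)) =
    (6 + v1^-1 + 2 * C3) * (n%:R * eps) * (2 * (a + 1))); last first.
    by field; rewrite ?subr_eq0 !gt_eqF.
  rewrite neps ler_peMr//; last by lra.
  by apply: mulr_ge0; [lra|exact: ltW].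
have PT : P setT = 1%E.
  by apply: tuple_product_measureT; exact: probability_setT.
have PE1 : (P E1 <= (N^-1)%:E)%E.
  apply: (le_trans (markov_ge0 P mU _ N0)) => [z|].
    rewrite integral_ge0// => theta _; rewrite lee_fin mulr_ge0//.
      by rewrite mulr_ge0 ?powR_ge0// exprn_ge0// invr_ge0 ltW// fine_affinity_gt0.
    by have := spike_slab_pdf_ge0 p v0 v1 theta; rewrite lee_fin.
  by rewrite integral_exp_moment// mule1.
have PE2 : (P E2 <= (N^-1)%:E)%E.
  apply: (le_trans (markov_ge0 P mW _ C0)) => [z|]; first by rewrite lee_fin ltW.
  apply: (@le_trans _ _ (C^-1%:E * (expR m)%:E)%E).
    by rewrite lee_wpmul2l ?lee_fin ?invr_ge0 ?(ltW C0)//; exact: integral_prod_norm2_le.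
  rewrite -EFinM lee_fin /C invfM -mulrA ler_piMr ?invr_ge0 ?(ltW N0)//.
  by rewrite -expRN -expRD -[leRHS]expR0 ler_expR; lra.
have : (1 <= P S + ((N^-1)%:E + (N^-1)%:E))%E.
  rewrite -PT; apply: (@le_trans _ _ (P (S `|` (E1 `|` E2)))).
    by rewrite le_measure ?inE//; apply: measurableU => //; exact: measurableU.
  apply: (le_trans (measureU2 _ mS _)); first exact: measurableU.
  by rewrite leeD2l// (le_trans (measureU2 _ mE1 mE2))// leeD.
rewrite -EFinD -leeBlDr//; apply: le_trans.
by rewrite -EFinB lee_fin (_ : 2 / N = N^-1 + N^-1)//; ring.
Qed.
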